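(* Let $U:\mathbb{R}^d\to\mathbb{R}$ be a $\mathcal{C}^2$ function such that $\nabla U(0)=0$ and, for two constants $0<m<L$, $m\,\mathrm{I}_d\preceq \nabla^2U(x)\preceq L\,\mathrm{I}_d$ for all $x\in\mathbb{R}^d$. Then for any step size $\eta\in(0,\frac{m}{L^2}]$, the randomized midpoint Langevin Monte Carlo Markov chain $(X_{k\eta})_{k\in\mathbb{N}_0}$ with transition kernel $Q_\eta$ is exponentially ergodic with a unique invariant probability measure $\pi_\eta$. More precisely, let $V(x)=1+|x|^2$, and for a probability measure $\nu$ on $\mathbb{R}^d$ with $\nu(V)=\int V\,\mathrm{d}\nu<\infty$ let $\nu Q_\eta^n$ be the law of $X_{n\eta}$ when $X_0$ has distribution $\nu$. Then there are positive constants $C$ and $c$, independent of $n$ (and of $\nu$), such that $$d_{\mathrm{TV},V}(\nu Q_\eta^n,\pi_\eta)\leq C(1+\nu(V))e^{-cn}$$ for all such $\nu$ and all $n\ge 1$.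
   Context: The randomized midpoint Langevin Monte Carlo (RLMC) chain with step size $\eta$ is defined for $k\ge0$ by $$X_{(k+1)\eta}=X_{k\eta}-\eta\nabla U(X_{(k+u_k)\eta})+\sqrt{2\eta}\,\xi_{k+1},\qquad X_{(k+u_k)\eta}=X_{k\eta}-u_k\eta\nabla U(X_{k\eta})+\sqrt{2u_k\eta}\,\xi_{k+1}',$$ where $(u_k)_{k\ge0}$ are i.i.d. uniform on $[0,1]$, and $(\xi_k)_{k\ge1}$, $(\xi_k')_{k\ge1}$ are mutually independent sequences of i.i.d. standard Gaussian vectors in $\mathbb{R}^d$, independent of $(u_k)$; all of these are independent of the initial value $X_0$. $Q_\eta$ is the one-step transition kernel of the Markov chain $(X_{k\eta})_{k\ge0}$ on $\mathbb{R}^d$. For measurable $V:\mathbb{R}^d\to\mathbb{R}_+$ and measurable $h:\mathbb{R}^d\to\mathbb{R}$, put $\|h\|_V=\sup_{x\in\mathbb{R}^d}\frac{|h(x)|}{1+V(x)}$, and for probability measures $\mu,\nu$ on $\mathbb{R}^d$ define the weighted total variation distance $$d_{\mathrm{TV},V}(\mu,\nu)=\sup_{h:\|h\|_V\le1}\Big\{\int_{\mathbb{R}^d}h(x)\mu(\mathrm{d}x)-\int_{\mathbb{R}^d}h(x)\nu(\mathrm{d}x)\Big\}.$$ *)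

(* Defs.v *)
From HB Require Import structures.
From mathcomp Require Import all_boot all_order all_algebra.
From mathcomp Require Import all_classical all_reals all_analysis.
From mathcomp Require Import measurable_realfun.

Set Implicit Arguments.
Unset Strict Implicit.
Unset Printing Implicit Defensive.
Import Order.TTheory GRing.Theory Num.Theory.
Import numFieldNormedType.Exports.

Local Open Scope classical_set_scope.
Local Open Scope ring_scope.

(* 'rV[R]_d carries the Borel sigma-algebra of its topology; measurable_fun_rVP
   and measurable_box relate it to the coordinates. *)
Definition rV_display : measure_display. Proof. exact. Qed.

Section borel_rV.
Variables (R : realType) (d : nat).

Let borel : set (set 'rV[R]_d) := <<s open >>.

Let borel0 : borel set0. Proof. exact: sigma_algebra0. Qed.

Let borelC A : borel A -> borel (~` A). Proof. exact: sigma_algebraC. Qed.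

Let borelU (F : (set 'rV[R]_d)^nat) :
  (forall i, borel (F i)) -> borel (\bigcup_i F i).
Proof. exact: sigma_algebra_bigcup. Qed.

HB.instance Definition _ :=
  @isMeasurable.Build rV_display 'rV[R]_d borel borel0 borelC borelU.

Lemma measurable_rVE : measurable = <<s open >> :> set (set 'rV[R]_d).
Proof. by []. Qed.

Lemma continuous_measurable_rV (f : 'rV[R]_d -> R) :
  continuous f -> measurable_fun setT f.
Proof.
move=> /continuousP cf; apply: (measurability _ (RGenOpens.measurableE R)).
move=> _ [_ [a [b ->] <-]]; rewrite setTI; apply: sub_sigma_algebra.
by apply: cf; exact: interval_open.
Qed.

Lemma measurable_coord (i : 'I_d) :
  measurable_fun setT (fun x : 'rV[R]_d => x 0 i).
Proof. by apply: continuous_measurable_rV => x; exact: coord_continuous. Qed.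

Let box (p : 'rV[rat]_d * nat) : set 'rV[R]_d :=
  [set x | forall i, ball (ratr (p.1 0 i) : R) p.2.+1%:R^-1 (x 0 i)].

Let open_bigcup_box (A : set 'rV[R]_d) : open A ->
  A = \bigcup_(p in [set p | box p `<=` A]) box p.
Proof.
move=> oA; apply/seteqP; split => [x Ax|x [p /= pA px]]; last exact: pA.
have /nbhs_ballP[e /= e0 xeA] := open_nbhs_nbhs (conj oA Ax).
have [n ne] : exists n : nat, n.+1%:R^-1 + n.+1%:R^-1 < e.
  have e20 : 0 < e / 2 by rewrite divr_gt0.
  have [n _ /(_ n (leqnn n)) /=] := near_infty_natSinv_lt (PosNum e20).
  rewrite /= => ne; exists n; rewrite [ltRHS](splitr e); exact: ltrD.
have n0 : (0 : R) < n.+1%:R^-1 by rewrite invr_gt0.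
have /choice[q qP] : forall i, exists q : rat,
    ball (ratr q : R) n.+1%:R^-1 (x 0 i).
  move=> i; have /rat_in_itvoo[q] : x 0 i - n.+1%:R^-1 < x 0 i + n.+1%:R^-1.
    by rewrite ltrD2l (lt_trans _ n0)// oppr_lt0.
  rewrite in_itv/= => /andP[q1 q2]; exists q.
  by rewrite /ball /= ltr_distl q1 q2.
exists (\row_i q i, n) => /= [y yq|i]; last by rewrite mxE.
apply: xeA; split => // i0 i; rewrite ord1.
have := yq i; rewrite mxE => yqi.
apply: le_ball (ltW ne) _ _.
exact: ball_triangle (ball_sym (qP i)) yqi.
Qed.

Lemma measurable_fun_rVP d' (T : measurableType d') (f : T -> 'rV[R]_d) :
  measurable_fun setT f <-> forall i, measurable_fun setT (fun t => f t 0 i).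
Proof.
split=> [mf i|mf].
  exact: (measurableT_comp (@measurable_coord i) mf).
apply: (@measurability _ _ _ _ setT f open) => //.
move=> _ [A oA <-]; rewrite setTI (open_bigcup_box oA) preimage_bigcup.
rewrite bigcup_mkcond; apply: countable_bigcupT_measurable => // p.
case: ifP => // _.
rewrite (_ : f @^-1` box p = \bigcap_(i in [set: 'I_d])
    ((fun t => f t 0 i) @^-1` ball (ratr (p.1 0 i) : R) p.2.+1%:R^-1)).
  apply: fin_bigcap_measurable => // i _; rewrite -[X in measurable X]setTI.
  by apply: mf => //; apply: open_measurable; exact: ball_open.
by apply/seteqP; split => t h i => [_|]; exact: h.
Qed.

Lemma measurable_box (A : 'I_d -> set R) : (forall i, measurable (A i)) ->
  measurable [set x : 'rV[R]_d | forall i, A i (x 0 i)].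
Proof.
move=> mA; rewrite (_ : mkset _ = \bigcap_(i in [set: 'I_d])
    ((fun x : 'rV[R]_d => x 0 i) @^-1` A i)).
  apply: fin_bigcap_measurable => // i _; rewrite -[X in measurable X]setTI.
  exact: measurable_coord.
by apply/seteqP; split => t h i => [_|]; exact: h.
Qed.

End borel_rV.

Section potential.
Variables (R : realType) (d : nat).
Implicit Types (U : 'rV[R]_d -> R) (x : 'rV[R]_d).

Definition grad U x : 'rV[R]_d := \row_i 'D_(delta_mx 0 i) U x.

Definition hess U x : 'M[R]_d :=
  \matrix_(i, j) 'D_(delta_mx 0 j) (fun y => grad U y 0 i) x.

(* grad and hess are built from directional derivatives; differentiable is
   Frechet differentiability, so hess U x is the matrix of the second Frechet
   derivative. *)
Definition C2 U : Prop :=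
  [/\ forall x, differentiable U x,
      forall x, differentiable (grad U) x
    & continuous (hess U)].

Definition loewner_le (A B : 'M[R]_d) : Prop :=
  forall v : 'rV[R]_d, 0 <= (v *m (B - A) *m v^T) 0 0.

(* The library norm `|x| on row vectors is the sup norm; sqenorm x is the square
   of the Euclidean norm. *)
Definition sqenorm x : R := \sum_i x 0 i ^+ 2.

Lemma measurable_grad U : C2 U -> measurable_fun setT (grad U).
Proof.
move=> [_ dgU _]; apply/measurable_fun_rVP => i.
apply: continuous_measurable_rV => x.
apply: (@continuous_comp _ _ _ (grad U) (fun y : 'rV[R]_d => y 0 i)).
  exact: differentiable_continuous.
exact: coord_continuous.
Qed.

End potential.

Section gaussian.
Variable R : realType.

Definition cons_rV d (z : measurableTypeR R * 'rV[R]_d) : 'rV[R]_d.+1 :=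
  \row_i oapp (z.2 0) z.1 (unlift ord0 i).

Lemma cons_rV0 d z : @cons_rV d z 0 ord0 = z.1.
Proof. by rewrite mxE unlift_none. Qed.

Lemma cons_rVS d z i : @cons_rV d z 0 (lift ord0 i) = z.2 0 i.
Proof. by rewrite mxE liftK. Qed.

Let measurable_cons_rV d : measurable_fun setT (@cons_rV d).
Proof.
apply/measurable_fun_rVP => i; case: (unliftP ord0 i) => [j ->|->].
  under eq_fun do rewrite cons_rVS.
  exact: measurableT_comp (measurable_coord j) measurable_snd.
  by under eq_fun do rewrite cons_rV0; exact: measurable_fst.
Qed.

HB.instance Definition _ d := isMeasurableFun.Build _ _ _ _ (@cons_rV d)
  (@measurable_cons_rV d).

(* The d-fold product of N(0, 1); std_gauss_box gives its value on boxes. *)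
Fixpoint std_gauss d : probability 'rV[R]_d R :=
  match d with
  | 0 => \d_(0 : 'rV[R]_0)
  | d'.+1 => distribution (normal_prob 0%R 1%R \x std_gauss d')%E (@cons_rV d')
  end.

Lemma std_gauss_box d (A : 'I_d -> set R) : (forall i, measurable (A i)) ->
  std_gauss d [set x | forall i, A i (x 0 i)] =
    (\prod_(i < d) normal_prob 0%R 1%R (A i))%E.
Proof.
elim: d A => [|d IHd] A mA /=.
  by rewrite big_ord0 diracE mem_set//= => -[].
rewrite big_ord_recl -IHd//.
have mB : measurable [set x : 'rV[R]_d | forall i, A (lift ord0 i) (x 0 i)].
  exact: (measurable_box (fun i => mA (lift ord0 i))).
rewrite -product_measure1E//; last exact: (mA ord0).
rewrite /distribution /pushforward /=.
congr ((_ \x _)%E _); apply/seteqP; split => z /=.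
  by move=> h; split => [|i]; [rewrite -(cons_rV0 z)|rewrite -cons_rVS].
move=> [z1 z2] i; case: (unliftP ord0 i) => [j ->|->].
  by rewrite cons_rVS.
by rewrite cons_rV0.
Qed.

End gaussian.

Section kernel_action.
Context d d' (X : measurableType d) (Y : measurableType d') (R : realType).
Variables (mu : probability X R) (k : R.-pker X ~> Y).

(* The law mu k of the next state when the current one has law mu. *)
Definition kact (A : set Y) : \bar R := (\int[mu]_x k x A)%E.

Let kact0 : kact set0 = 0%E.
Proof. by apply: integral0_eq => x _; rewrite measure0. Qed.

Let kact_ge0 A : (0 <= kact A)%E.
Proof. exact: integral_ge0. Qed.

Let kact_sigma_additive : semi_sigma_additive kact.
Proof.
move=> F mF tF mUF; rewrite [X in _ --> X](_ : _ =
  (\int[mu]_x \sum_(n <oo) k x (F n))%E); last first.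
  by apply: eq_integral => x _; rewrite measure_semi_bigcup.
apply: cvg_toP.
  apply: ereal_nondecreasing_is_cvgn => m n mn.
  by apply: lee_sum_nneg_natr => // i _ _; exact: kact_ge0.
by rewrite integral_nneseries// => n; exact: measurable_kernel.
Qed.

HB.instance Definition _ :=
  isMeasure.Build _ _ _ kact kact0 kact_ge0 kact_sigma_additive.

Let kactT : kact setT = 1%E.
Proof.
rewrite /kact; under eq_integral do rewrite prob_kernel.
by rewrite integral_cst//= mul1e; exact: probability_setT.
Qed.

HB.instance Definition _ := Measure_isProbability.Build _ _ _ kact kactT.

End kernel_action.

Section kernel_iterates.
Context d (X : measurableType d) (R : realType).
Variable k : R.-pker X ~> X.

Fixpoint kiter (nu : probability X R) (n : nat) : probability X R :=
  match n with
  | 0 => nu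
  | n'.+1 => kact (kiter nu n') k
  end.

Definition invariant_measure (pi : probability X R) : Prop :=
  forall A, measurable A -> kact pi k A = pi A.

End kernel_iterates.

Section weighted_tv.
Context d (X : measurableType d) (R : realType).
Variable V : X -> R.
Local Open Scope ereal_scope.

Definition wnorm (h : X -> R) : \bar R :=
  ereal_sup (range (fun x => (`|h x| / (1 + V x))%:E)).

(* When both measures integrate V, every integral below is finite. If exactly
   one does, h := V and h := - V show that the supremum is +oo. *)
Definition dTV (mu nu : probability X R) : \bar R :=
  ereal_sup [set \int[mu]_x (h x)%:E - \int[nu]_x (h x)%:E |
    h in [set h | measurable_fun [set: X] h /\ wnorm h <= 1]].

End weighted_tv.

Section rlmc.
Variables (R : realType) (d : nat) (U : 'rV[R]_d -> R) (eta : R).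
Implicit Types (x g : 'rV[R]_d) (u : R).

Definition rlmc_mid x u g : 'rV[R]_d :=
  x - (u * eta) *: grad U x + Num.sqrt (2 * u * eta) *: g.

Definition rlmc_step x u g g' : 'rV[R]_d :=
  x - eta *: grad U (rlmc_mid x u g') + Num.sqrt (2 * eta) *: g.

(* Joint law of (u_k, (xi_{k+1}, xi'_{k+1})). *)
Definition rlmc_noise : probability _ R :=
  (uniform_prob (@ltr01 R) \x (std_gauss R d \x std_gauss R d))%E.

(* hU is not used by the function itself; it is an argument so that the
   measurability of the update can be inferred. *)
Definition rlmc_update (hU : C2 U) x
    (z : measurableTypeR R * ('rV[R]_d * 'rV[R]_d)) : 'rV[R]_d :=
  rlmc_step x z.1 z.2.1 z.2.2.

Let measurable_rVDZ d' (T : measurableType d') (f g : T -> 'rV[R]_d)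
    (a : T -> R) :
  measurable_fun setT f -> measurable_fun setT g -> measurable_fun setT a ->
  measurable_fun setT (fun t => f t + a t *: g t).
Proof.
move=> /measurable_fun_rVP mf /measurable_fun_rVP mg ma.
apply/measurable_fun_rVP => i; under eq_fun do rewrite !mxE.
by apply: measurable_funD; [exact: mf|apply: measurable_funM; [|exact: mg]].
Qed.

Lemma measurable_rlmc_step d' (T : measurableType d') (x g g' : T -> 'rV[R]_d)
    (u : T -> R) : C2 U ->
  measurable_fun setT x -> measurable_fun setT u ->
  measurable_fun setT g -> measurable_fun setT g' ->
  measurable_fun setT (fun t => rlmc_step (x t) (u t) (g t) (g' t)).
Proof.
move=> hU mx mu mg mg'; have mgrad := measurable_grad hU.
rewrite /rlmc_step; apply: measurable_rVDZ => //.
under eq_fun do rewrite -scaleNr.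
apply: measurable_rVDZ => //; apply: (measurableT_comp mgrad).
rewrite /rlmc_mid; apply: measurable_rVDZ => //.
- under eq_fun do rewrite -scaleNr.
  apply: measurable_rVDZ => //; first exact: (measurableT_comp mgrad).
  by apply: measurable_funN; exact: measurable_funM.
- apply: (@measurableT_comp _ _ _ _ _ _ (@Num.sqrt R)).
    by apply: continuous_measurable_fun; exact: sqrt_continuous.
  by apply: measurable_funM => //; exact: measurable_funM.
Qed.

Lemma measurable_rlmc_update (hU : C2 U) :
  measurable_fun setT (fun p => rlmc_update hU p.1 p.2).
Proof.
pose T : Type := ('rV[R]_d * (measurableTypeR R * ('rV[R]_d * 'rV[R]_d)))%type.
have m2 : measurable_fun setT (fun p : T => p.2.2).
  exact: measurableT_comp measurable_snd measurable_snd.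
apply: measurable_rlmc_step => //.
- exact: measurableT_comp measurable_fst measurable_snd.
- exact: measurableT_comp measurable_fst m2.
- exact: measurableT_comp measurable_snd m2.
Qed.

Let measurable_rlmc_update2 (hU : C2 U) x :
  measurable_fun setT (rlmc_update hU x).
Proof.
exact: measurableT_comp (measurable_rlmc_update hU) (measurable_pair1 x).
Qed.

HB.instance Definition _ (hU : C2 U) x := isMeasurableFun.Build _ _ _ _
  (rlmc_update hU x) (@measurable_rlmc_update2 hU x).

Definition rlmc_kernel (hU : C2 U) x : {measure set 'rV[R]_d -> \bar R} :=
  distribution rlmc_noise (rlmc_update hU x).

Let measurable_rlmc_kernel (hU : C2 U) (A : set 'rV[R]_d) :
  measurable A -> measurable_fun setT ((rlmc_kernel hU)^~ A).
Proof.
move=> mA.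
have mB := measurable_rlmc_update hU measurableT mA; rewrite setTI in mB.
rewrite [X in measurable_fun _ X](_ : _ = (fun x => rlmc_noise (xsection
    ((fun p => rlmc_update hU p.1 p.2) @^-1` A) x))).
  exact: measurable_fun_xsection.
apply/funext => x; congr (rlmc_noise _); apply/seteqP; split => z /=;
  by rewrite /xsection /= inE.
Qed.

HB.instance Definition _ hU := isKernel.Build _ _ _ _ _ (rlmc_kernel hU)
  (@measurable_rlmc_kernel hU).

Let prob_rlmc_kernel (hU : C2 U) x : rlmc_kernel hU x setT = 1%E.
Proof. exact: probability_setT. Qed.

HB.instance Definition _ hU := Kernel_isProbability.Build _ _ _ _ _
  (rlmc_kernel hU) (@prob_rlmc_kernel hU).

End rlmc.

Section independence.
Context d (T : measurableType d) (R : realType) (P : probability T R).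

Definition sigma_rv d' (T' : measurableType d') (X : T -> T') : set (set T) :=
  preimage_set_system setT X measurable.

Definition mutually_independent (I : eqType) (F : I -> set (set T)) : Prop :=
  forall (s : seq I) (A : I -> set T), uniq s ->
    (forall i, i \in s -> F i (A i)) ->
    P (\bigcap_(i in [set` s]) A i) = (\prod_(i <- s) P (A i))%E.

End independence.

Section chain.
Context dO (Omega : measurableType dO) (R : realType) (d : nat).
Variable P : probability Omega R.
Variables (X0 : {RV P >-> 'rV[R]_d}) (u : nat -> {RV P >-> R}).
(* xi k and xi' k stand for xi_{k+1} and xi'_{k+1}. *)
Variables (xi xi' : nat -> {RV P >-> 'rV[R]_d}).

Definition rlmc_sigma (i : unit + (nat + (nat + nat))) : set (set Omega) :=
  match i with
  | inl _ => sigma_rv X0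
  | inr (inl k) => sigma_rv (u k)
  | inr (inr (inl k)) => sigma_rv (xi k)
  | inr (inr (inr k)) => sigma_rv (xi' k)
  end.

Record rlmc_driving : Prop := RLMCDriving {
  u_uniform : forall k A, measurable A ->
    P (u k @^-1` A) = uniform_prob (@ltr01 R) A ;
  xi_gauss : forall k A, measurable A -> P (xi k @^-1` A) = std_gauss R d A ;
  xi'_gauss : forall k A, measurable A -> P (xi' k @^-1` A) = std_gauss R d A ;
  driving_indep : mutually_independent P rlmc_sigma }.

Fixpoint rlmc_chain (U : 'rV[R]_d -> R) (eta : R) (k : nat) (w : Omega) :
    'rV[R]_d :=
  match k with
  | 0 => X0 w
  | k'.+1 =>
      rlmc_step U eta (rlmc_chain U eta k' w) (u k' w) (xi k' w) (xi' k' w)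
  end.

End chain.

(* Main.v *)
Require Import Defs.
From HB Require Import structures.
From mathcomp Require Import all_boot all_order all_algebra.
From mathcomp Require Import all_classical all_reals all_analysis.
From mathcomp Require Import measurable_realfun ring lra.

Set Implicit Arguments.
Unset Strict Implicit.
Unset Printing Implicit Defensive.
Import Order.TTheory GRing.Theory Num.Theory.
Import numFieldNormedType.Exports.

Local Open Scope classical_set_scope.
Local Open Scope ring_scope.

(** The law of the chain and the ergodic theorem are proved separately.

    The chain is a random recursion with fresh noise at each step. By induction
    on [n], the state at time [n] is independent of all the noise from time [n]
    on ([chain_independence]), so that its law is pushed forward by the kernel
    at each step ([chain_law]).

    The ergodic statement is Harris' theorem ([harris]) for the Lyapunov function
    [1 + |x|^2]. It is proved in the dual form of Hairer and Mattingly: for a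
    small [beta], the kernel contracts the oscillation seminorm of a function
    relative to the weight [2 + beta V x + beta V y] ([kop_contraction]). Far from
    the centre the contraction comes from the drift [Q V <= lam V + K], near the
    centre from a component common to all the transition measures. Integrating
    against two initial laws gives a geometric bound on the weighted total
    variation distance ([dTV_contraction]). The iterates started from a point are
    therefore Cauchy, uniformly over the measurable sets; their limit is a
    probability measure ([uniform_cauchy_probability]), and Fatou's lemma for
    setwise convergence ([setwise_fatou]) shows that this limit is invariant and
    integrates [V].

    For the drift, the quadratic bounds on the Hessian give, along segments, the
    strong monotonicity and the cocoercivity of the gradient
    ([grad_strongly_monotone], [grad_cocoercive]). With [x'] the noiseless
    midpoint, [eta <= m / L^2] yields [eta |grad U x'|^2 <= <x', grad U x'>],
    hence [|x - eta grad U x'|^2 <= |x|^2 - eta m |x'|^2], and [|x'|] is at least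
    [(1 - m / L) |x|] ([noiseless_step_le]). The Gaussian terms have finite second
    moments and are absorbed by Young's inequality ([rlmc_kernel_drift]).

    For the common component, the last Gaussian term of a step is independent of
    the rest. When the uniform variable is in [0, 1], the inner Gaussian in
    [-1, 1]^d and [x] in a sublevel set of [V], the mean of the next state stays
    in a bounded set; and Gaussian vectors with means in a bounded set
    dominate a common multiple of the uniform law on a cube
    ([std_gauss_affine_minorization], [rlmc_kernel_minorization]). *)

(** * The Euclidean inner product on row vectors *)

Section inner_product.
Variables (R : realType) (d : nat).
Implicit Types (x y z : 'rV[R]_d) (a : R).

Definition dot x y : R := \sum_i x 0 i * y 0 i.

Lemma sqenormE x : sqenorm x = dot x x.
Proof. by apply: eq_bigr => i _; rewrite expr2. Qed.

Lemma dotC x y : dot x y = dot y x.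
Proof. by apply: eq_bigr => i _; rewrite mulrC. Qed.

Lemma dotDl x y z : dot (x + y) z = dot x z + dot y z.
Proof.
by rewrite /dot -big_split; apply: eq_bigr => i _; rewrite mxE mulrDl.
Qed.

Lemma dotZl a x y : dot (a *: x) y = a * dot x y.
Proof. by rewrite /dot mulr_sumr; apply: eq_bigr => i _; rewrite mxE mulrA. Qed.

Lemma dotNl x y : dot (- x) y = - dot x y.
Proof. by rewrite -scaleN1r dotZl mulN1r. Qed.

Lemma dotDr x y z : dot z (x + y) = dot z x + dot z y.
Proof. by rewrite dotC dotDl !(dotC z). Qed.

Lemma dotZr a x y : dot y (a *: x) = a * dot y x.
Proof. by rewrite dotC dotZl dotC. Qed.

Lemma dotNr x y : dot y (- x) = - dot y x.
Proof. by rewrite dotC dotNl dotC. Qed.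

Definition dotE := (dotDl, dotDr, dotNl, dotNr, dotZl, dotZr).

Lemma dot_ge0 x : 0 <= dot x x.
Proof. by rewrite -sqenormE; apply: sumr_ge0 => i _; exact: sqr_ge0. Qed.

Lemma sqenorm_ge0 x : 0 <= sqenorm x.
Proof. by rewrite sqenormE dot_ge0. Qed.

Lemma sqenormN x : sqenorm (- x) = sqenorm x.
Proof. by rewrite !sqenormE dotNl dotNr opprK. Qed.

Lemma dot_ge0_near x y : sqenorm (y - x) <= sqenorm x -> 0 <= dot x y.
Proof.
by rewrite !sqenormE !dotE (dotC y x); have := dot_ge0 y; lra.
Qed.

(** The weighted form of Young's inequality, from
    [0 <= |e x - y|^2 / e]. *)
Lemma sqenormD_le x y (e : R) : 0 < e ->
  sqenorm (x + y) <= (1 + e) * sqenorm x + (1 + e^-1) * sqenorm y.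
Proof.
move=> e0; rewrite !sqenormE.
have := dot_ge0 (e *: x - y); rewrite !dotE (dotC y x) => h.
have h' : 0 <= e^-1 * (e * (e * dot x x) - 2 * e * dot x y + dot y y).
  by rewrite mulr_ge0 ?invr_ge0 ?(ltW e0)//; lra.
have -> : (1 + e) * dot x x + (1 + e^-1) * dot y y =
    (dot x x + dot y y + 2 * dot x y) +
    e^-1 * (e * (e * dot x x) - 2 * e * dot x y + dot y y).
  by field; rewrite gt_eqF.
lra.
Qed.

End inner_product.

(** * Strongly convex functions with Lipschitz gradient *)

Section convexity.
Variables (R : realType) (d : nat) (U : 'rV[R]_d -> R) (m L : R).
Hypotheses (hU : C2 U)
  (hessU : forall x : 'rV[R]_d,
      loewner_le m%:M (hess U x) /\ loewner_le (hess U x) L%:M).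
Implicit Types (x y v : 'rV[R]_d).

Let line x v (t : R) : 'rV[R]_d := t *: v + x.

Lemma derive_line (f : 'rV[R]_d -> R) x v (t : R) :
  differentiable f (line x v t) ->
  is_derive t 1 (f \o line x v) ('D_v f (line x v t)).
Proof.
move=> df; have : is_derive (line x v t) v f ('D_v f (line x v t)).
  by apply: derivableP; exact: diff_derivable.
have E : (fun h : R =>
      h^-1 *: ((f \o line x v) (h *: 1 + t) - (f \o line x v) t)) =
    (fun h : R => h^-1 *: (f (h *: v + line x v t) - f (line x v t))).
  apply/funext => h; rewrite /line /=.
  by rewrite [h *: 1]mulr1 scalerDl addrA.
by case=> dv dE; split; [rewrite /derivable E|rewrite /derive E].
Qed.

Lemma derive_dir (f : 'rV[R]_d -> R) x v : differentiable f x ->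
  'D_v f x = \sum_i v 0 i * 'D_(delta_mx 0 i) f x.
Proof.
move=> df; rewrite deriveE// {1}[v]row_sum_delta linear_sum.
by apply: eq_bigr => i _; rewrite linearZ deriveE.
Qed.

Lemma derive_dot_grad x v (t : R) :
  is_derive t 1 (fun t => dot (grad U (line x v t)) v)
    ((v *m hess U (line x v t) *m v^T) 0 0).
Proof.
have [_ dg _] := hU.
have dgi i y : differentiable (fun y => grad U y 0 i) y.
  exact: (differentiable_comp (dg y) (differentiable_coord (grad U y) 0 i)).
have -> : (fun t => dot (grad U (line x v t)) v) =
    \sum_(i < d) (v 0 i *: ((fun y => grad U y 0 i) \o line x v)).
  by apply/funext => s; rewrite fct_sumE; apply: eq_bigr => i _; exact: mulrC.
have -> : (v *m hess U (line x v t) *m v^T) 0 0 =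
    \sum_(i < d) v 0 i *: 'D_v (fun y => grad U y 0 i) (line x v t).
  rewrite -mulmxA mxE; apply: eq_bigr => i _; congr (_ * _).
  rewrite derive_dir// mxE; apply: eq_bigr => j _.
  by rewrite !mxE mulrC.
by apply: is_derive_sum => i; apply: is_deriveZ; exact: derive_line.
Qed.

Lemma derive_U_line x v (t : R) :
  is_derive t 1 (U \o line x v) (dot (grad U (line x v t)) v).
Proof.
have [dU _ _] := hU.
rewrite (_ : dot _ _ = 'D_v U (line x v t)); first exact: derive_line.
by rewrite derive_dir//; apply: eq_bigr => i _; rewrite mxE mulrC.
Qed.

Lemma hess_bounds x v :
  m * dot v v <= (v *m hess U x *m v^T) 0 0 <= L * dot v v.
Proof.
have vv : (v *m v^T) 0 0 = dot v v.
  by rewrite mxE; apply: eq_bigr => i _; rewrite mxE.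
have [/(_ v) + /(_ v)] := hessU x; rewrite !mulmxBr !mulmxBl !mul_mx_scalar.
by rewrite -!scalemxAl !mxE -!vv !mxE !subr_ge0 => -> ->.
Qed.

Let line0 x v : line x v 0 = x.
Proof. by rewrite /line scale0r add0r. Qed.

Let within_cont (f df : R -> R) (A : set R) :
  (forall t : R, is_derive t 1 f (df t)) -> {within A, continuous f}.
Proof.
move=> fd; apply: continuous_subspaceT => t.
by apply/differentiable_continuous/derivable1_diffP; case: (fd t).
Qed.

(** Along a segment the derivative of the gradient is a value of the quadratic
    form of the Hessian, which lies between [m |v|^2] and [L |v|^2]. *)
Lemma dot_grad_line x v (t : R) : 0 <= t ->
  m * dot v v * t <= dot (grad U (line x v t) - grad U x) v <=
    L * dot v v * t.
Proof.
move=> t0.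
have [c _] := MVT_segment t0 (fun s _ => derive_dot_grad x v s)
  (within_cont (derive_dot_grad x v) (A := _)).
rewrite line0 subr0 dotDl dotNl => ->.
by have /andP[? ?] := hess_bounds (line x v c) v; rewrite !ler_wpM2r.
Qed.

Lemma grad_strongly_monotone x y :
  m * sqenorm (y - x) <= dot (grad U y - grad U x) (y - x).
Proof.
have /andP[+ _] := dot_grad_line x (y - x) ler01.
by rewrite sqenormE mulr1 /line scale1r subrK.
Qed.

(** The quadratic upper bound: [t |-> U (x + t v) - t <grad U x, v> -
    L |v|^2 t^2 / 2] is nonincreasing on [0, 1]. *)
Lemma descent_lemma x v :
  U (v + x) <= U x + dot (grad U x) v + L / 2 * dot v v.
Proof.
pose F := (U \o line x v) - (fun t : R => t * dot (grad U x) v) -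
  (fun t : R => L / 2 * dot v v * t ^+ 2).
have dF (t : R) : is_derive t 1 F
    (dot (grad U (line x v t)) v - dot (grad U x) v - L * dot v v * t).
  apply: is_deriveB.
    apply: is_deriveB; first exact: derive_U_line.
    have -> : (fun t : R => t * dot (grad U x) v) = dot (grad U x) v \*: id.
      by apply/funext => s; exact: mulrC.
    by apply: is_derive_eq; rewrite /GRing.scale/= mulr1.
  have -> : (fun t : R => L / 2 * dot v v * t ^+ 2) =
      (L / 2 * dot v v) \*: (id ^+ 2 : R -> R) by apply/funext.
  by apply: is_derive_eq; rewrite /GRing.scale/=; field.
have [c c01] := MVT_segment ler01 (fun s _ => dF s) (within_cont dF (A := _)).
have c0 : 0 <= c by move: c01; rewrite in_itv => /andP[].
have /andP[_] := dot_grad_line x v c0; rewrite dotDl dotNl => h1.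
rewrite /F /line !fctE /= scale1r scale0r add0r expr0n /= expr1n.
lra.
Qed.

Lemma tangent_le x v : 0 <= m -> U x + dot (grad U x) v <= U (v + x).
Proof.
move=> m0.
have [c c01] := MVT_segment ler01 (fun s _ => derive_U_line x v s)
  (within_cont (derive_U_line x v) (A := _)).
have c0 : 0 <= c by move: c01; rewrite in_itv => /andP[].
have /andP[+ _] := dot_grad_line x v c0; rewrite dotDl dotNl => h1.
rewrite /line /= scale1r scale0r add0r => h2.
have : 0 <= m * dot v v * c by rewrite !mulr_ge0// dot_ge0.
lra.
Qed.

(** The gap between a convex function and its tangent plane at [x] controls
    the gradient: compare the value at [y] with the one after the gradient step
    [y - L^-1 (grad U y - grad U x)]. *)
Lemma bregman_ge x y : 0 <= m -> 0 < L ->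
  (2 * L)^-1 * sqenorm (grad U y - grad U x) <=
    U y - U x - dot (grad U x) (y - x).
Proof.
move=> m0 L0; rewrite sqenormE; set D := grad U y - grad U x.
have DE : D = grad U y - grad U x by []; clearbody D.
have := descent_lemma y (- L^-1 *: D).
have := tangent_le x (- L^-1 *: D + y - x) m0.
rewrite subrK !dotE => h1 h2.
have : dot (grad U y) D = dot (grad U x) D + dot D D.
  by rewrite {3}DE dotDl dotNl; lra.
move=> h3; rewrite h3 in h2.
have e : L / 2 * (- L^-1 * (- L^-1 * dot D D)) = (2 * L)^-1 * dot D D.
  by field; rewrite gt_eqF.
have e' : L^-1 * dot D D = 2 * ((2 * L)^-1 * dot D D).
  by field; rewrite gt_eqF.
rewrite e in h2; lra.
Qed.

(** The Baillon-Haddad inequality: add the lower bounds on the two Bregman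
    divergences between [x] and [y]. *)
Lemma grad_cocoercive x y : 0 <= m -> 0 < L ->
  sqenorm (grad U y - grad U x) <= L * dot (grad U y - grad U x) (y - x).
Proof.
move=> m0 L0; have h1 := bregman_ge x y m0 L0; have h2 := bregman_ge y x m0 L0.
rewrite -[X in sqenorm X]opprB in h2.
rewrite sqenormN -[X in _ <= _ - dot _ X]opprB in h2.
set S := sqenorm _ in h1 h2 *.
have e2 : S = L * ((2 * L)^-1 * S + (2 * L)^-1 * S) by field; rewrite gt_eqF.
rewrite e2 ler_pM2l// dotDl dotNl; rewrite dotNr in h2; lra.
Qed.

(** From cocoercivity and [0 <= |D - L v|^2], where [D] is the increment of the
    gradient along [v]. *)
Lemma grad_lipschitz x y : 0 <= m -> 0 < L ->
  sqenorm (grad U y - grad U x) <= L ^+ 2 * sqenorm (y - x).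
Proof.
move=> m0 L0; have := grad_cocoercive x y m0 L0; rewrite !sqenormE.
move: (_ - _) (y - x) => D v h.
have := dot_ge0 (D - L *: v); rewrite !dotE (dotC v D) => h2.
by have : 2 * (L * dot D v) <= dot D D + L * (L * dot v v); lra.
Qed.

End convexity.

(** * The drift of one step of the chain *)

Section drift.
Variables (R : realType) (d : nat) (U : 'rV[R]_d -> R) (m L : R).
Hypotheses (hU : C2 U) (gradU0 : grad U 0 = 0) (m_gt0 : 0 < m) (m_lt_L : m < L)
  (hessU : forall x : 'rV[R]_d,
      loewner_le m%:M (hess U x) /\ loewner_le (hess U x) L%:M).
Variable eta : R.
Hypotheses (eta_gt0 : 0 < eta) (eta_le : eta <= m / L ^+ 2).
Implicit Types (x g : 'rV[R]_d) (u : R).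

Let L_gt0 : 0 < L. Proof. exact: lt_trans m_lt_L. Qed.

Let etaL2 : eta * L ^+ 2 <= m.
Proof. by rewrite -ler_pdivlMr// exprn_gt0. Qed.

Let etaL : eta * L <= m / L.
Proof.
have -> : eta * L = (eta * L ^+ 2) / L by field; rewrite gt_eqF.
by rewrite ler_pM2r// invr_gt0.
Qed.

Let q_lt1 : m / L < 1. Proof. by rewrite ltr_pdivrMr// mul1r. Qed.

Let q_gt0 : 0 < m / L. Proof. exact: divr_gt0. Qed.

Definition drift_rate : R := 1 - eta * m * (1 - m / L) ^+ 2.

Lemma drift_rate_lt1 : drift_rate < 1.
Proof.
by rewrite /drift_rate gtrBl !mulr_gt0// ?exprn_gt0// subr_gt0.
Qed.

Lemma drift_rate_ge0 : 0 <= drift_rate.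
Proof.
rewrite /drift_rate subr_ge0.
have h1 : eta * m <= 1.
  have -> : eta * m = (eta * L) * (m / L) by field; rewrite gt_eqF.
  have h0 : 0 <= eta * L by rewrite mulr_ge0// ltW.
  have hL : eta * L <= 1 by exact: le_trans etaL (ltW q_lt1).
  exact: mulr_ile1 h0 (ltW q_gt0) hL (ltW q_lt1).
have h2 : (1 - m / L) ^+ 2 <= 1.
  by rewrite expr_le1// ?subr_ge0 ?(ltW q_lt1)// lerBlDr lerDl ltW.
by rewrite mulr_ile1 ?sqr_ge0// mulr_ge0// ltW.
Qed.

Lemma grad_sqenorm_le x : sqenorm (grad U x) <= L ^+ 2 * sqenorm x.
Proof.
by have := grad_lipschitz hU hessU 0 x (ltW m_gt0) L_gt0; rewrite gradU0 !subr0.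
Qed.

Lemma dot_grad_le x : dot (grad U x) x <= L * dot x x.
Proof.
have := grad_sqenorm_le x; rewrite !sqenormE => h.
have := dot_ge0 (grad U x - L *: x); rewrite !dotE (dotC x) => h2.
rewrite -(ler_pM2l L_gt0); lra.
Qed.

(** Pairing with [x] gives [<x, x'> >= (1 - m / L) |x|^2], since
    [t <x, grad U x> <= eta L |x|^2]; conclude by [0 <= |x' - (1 - m / L) x|^2]. *)
Lemma midpoint_sqenorm_ge x t : 0 <= t -> t <= eta ->
  (1 - m / L) ^+ 2 * sqenorm x <= sqenorm (x - t *: grad U x).
Proof.
move=> t0 teta; rewrite !sqenormE; set y : 'rV[R]_d := x - t *: grad U x.
have h : (1 - m / L) * dot x x <= dot x y.
  rewrite /y !dotE (dotC x (grad U x)) mulrBl mul1r lerD2l lerN2.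
  apply: (@le_trans _ _ (t * (L * dot x x))).
    by rewrite ler_wpM2l// dot_grad_le.
  rewrite mulrA ler_wpM2r ?dot_ge0//.
  by apply: le_trans etaL; rewrite ler_wpM2r// ltW.
clearbody y.
have := dot_ge0 (y - (1 - m / L) *: x); rewrite !dotE (dotC y x) => h2.
have h3 : (1 - m / L) * ((1 - m / L) * dot x x) <= (1 - m / L) * dot x y.
  by rewrite ler_wpM2l// subr_ge0 ltW.
rewrite expr2 -mulrA; lra.
Qed.

(** The noiseless midpoint step contracts towards the minimiser of [U]:
    [<x, grad U x'> = <x', grad U x'> + u eta <grad U x, grad U x'>], the last
    product is nonnegative because the two gradients differ by at most
    [L u eta |grad U x| <= |grad U x|], and [eta |grad U x'|^2 <=
    <x', grad U x'>] by the bound on the step size. *)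
Lemma noiseless_step_le x u : 0 <= u -> u <= 1 ->
  sqenorm (x - eta *: grad U (x - (u * eta) *: grad U x)) <=
    drift_rate * sqenorm x.
Proof.
move=> u0 u1.
have t0 : 0 <= u * eta by rewrite mulr_ge0// ltW.
have teta : u * eta <= eta by rewrite ler_piMl// ltW.
have h1 := midpoint_sqenorm_ge x t0 teta.
move: (u * eta) t0 teta h1 => t t0 teta.
set y : 'rV[R]_d := x - t *: grad U x => h1.
have xE : x = y + t *: grad U x by rewrite /y subrK.
have yx : y - x = - (t *: grad U x) by rewrite /y addrC addrA addNr add0r.
clearbody y.
have h2 : m * dot y y <= dot (grad U y) y.
  have := grad_strongly_monotone hU hessU 0 y.
  by rewrite gradU0 !subr0 sqenormE.
have h3 := grad_sqenorm_le y; rewrite sqenormE in h3.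
have h4 := grad_lipschitz hU hessU x y (ltW m_gt0) L_gt0.
rewrite yx sqenormN (sqenormE (_ *: _)) !dotE in h4.
have h5 : L ^+ 2 * (t * (t * dot (grad U x) (grad U x))) <=
    dot (grad U x) (grad U x).
  rewrite !mulrA ler_piMl ?dot_ge0//.
  have -> : L ^+ 2 * t * t = (t * L) ^+ 2 by ring.
  rewrite expr_le1// ?mulr_ge0 ?(ltW L_gt0)//.
  apply: le_trans (ltW q_lt1); apply: le_trans etaL.
  by rewrite ler_wpM2r// ltW.
have h6 : 0 <= dot (grad U x) (grad U y).
  by apply: dot_ge0_near; rewrite [leRHS]sqenormE (le_trans h4).
have h7 : dot x (grad U y) = dot (grad U y) y + t * dot (grad U x) (grad U y).
  by rewrite {1}xE !dotE (dotC y).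
have h8 : eta * dot (grad U y) (grad U y) <= dot (grad U y) y.
  apply: le_trans h2; apply: (le_trans (ler_wpM2l (ltW eta_gt0) h3)).
  by rewrite sqenormE mulrA ler_wpM2r ?dot_ge0.
have h9 : 0 <= t * dot (grad U x) (grad U y) by rewrite mulr_ge0.
rewrite sqenormE !dotE (dotC (grad U y) x) h7 /drift_rate.
rewrite -!sqenormE in h1 h2 *.
have h10 : eta * (eta * sqenorm (grad U y)) <= eta * dot (grad U y) y.
  by rewrite ler_wpM2l ?(ltW eta_gt0)// sqenormE.
have h11 : 0 <= eta * (t * dot (grad U x) (grad U y)) by rewrite mulr_ge0// ltW.
have h12 : eta * (m * ((1 - m / L) ^+ 2 * sqenorm x)) <=
    eta * dot (grad U y) y.
  rewrite ler_wpM2l ?(ltW eta_gt0)//; apply: le_trans h2.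
  by rewrite ler_wpM2l// ltW.
move: (dot (grad U y) y) (dot (grad U x) (grad U y)) (sqenorm x) h10 h11 h12
  => A B S h10 h11 h12.
lra.
Qed.

(** Adding the two Gaussian perturbations costs an arbitrarily small part of
    the contraction and a multiple of their squared norms. *)
Lemma rlmc_step_drift : exists lam K : R, [/\ 0 <= lam, lam < 1, 0 <= K &
  forall x u g g', 0 <= u <= 1 ->
    sqenorm (rlmc_step U eta x u g g') <=
      lam * sqenorm x + K * (sqenorm g + sqenorm g')].
Proof.
have rho0 := drift_rate_ge0; have rho1 := drift_rate_lt1.
(* [e] is small enough for [(1 + e) * drift_rate] to stay below 1. *)
pose e := (1 - drift_rate) / 2.
have e0 : 0 < e by rewrite divr_gt0// subr_gt0.
have C0 : 0 <= 1 + e^-1 by rewrite addr_ge0// invr_ge0 ltW.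
pose M := 4 * eta + 4 * eta * (eta ^+ 2 * L ^+ 2).
have eL0 : 0 <= eta * (eta ^+ 2 * L ^+ 2).
  by rewrite !mulr_ge0 ?exprn_ge0// ltW.
have M0 : 0 <= M.
  have -> : M = 4 * eta + 4 * (eta * (eta ^+ 2 * L ^+ 2)) by rewrite /M; ring.
  by rewrite addr_ge0// mulr_ge0// ltW.
exists ((1 + e) * drift_rate), ((1 + e^-1) * M); split.
- by rewrite mulr_ge0// addr_ge0// ltW.
- have : 0 < (1 - drift_rate) * (1 - drift_rate / 2).
    by rewrite mulr_gt0//; lra.
  by rewrite /e; lra.
- by rewrite mulr_ge0.
move=> x u g g' /andP[u0 u1].
set y : 'rV[R]_d := x - (u * eta) *: grad U x.
have -> : rlmc_step U eta x u g g' = (x - eta *: grad U y) +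
    (Num.sqrt (2 * eta) *: g -
      eta *: (grad U (rlmc_mid U eta x u g') - grad U y)).
  rewrite /rlmc_step scalerBr; set a := _ *: g; set b := _ *: grad U y.
  set c := _ *: grad U _.
  by clearbody a b c; apply/rowP => i; rewrite !mxE; ring.
apply: (le_trans (sqenormD_le _ _ e0)).
have h1 := noiseless_step_le x u0 u1; rewrite -/y in h1.
have h2 := grad_lipschitz hU hessU y (rlmc_mid U eta x u g') (ltW m_gt0) L_gt0.
rewrite (_ : rlmc_mid U eta x u g' - y = Num.sqrt (2 * u * eta) *: g') in h2;
  last by rewrite /rlmc_mid -/y addrAC subrr add0r.
have sZ (a : R) (z : 'rV[R]_d) : sqenorm (a *: z) = a ^+ 2 * sqenorm z.
  by rewrite !sqenormE !dotE mulrA expr2.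
rewrite sZ sqr_sqrtr in h2; last by rewrite !mulr_ge0// ltW.
set D := grad U _ - grad U y in h2 *.
have h3 := sqenormD_le (Num.sqrt (2 * eta) *: g) (- (eta *: D)) ltr01.
rewrite sqenormN !sZ sqr_sqrtr ?mulr_ge0 ?(ltW eta_gt0)// invr1 in h3.
have h4 : (1 + e) * sqenorm (x - eta *: grad U y) <=
    (1 + e) * (drift_rate * sqenorm x).
  by rewrite ler_wpM2l// addr_ge0// ltW.
have h5 : eta ^+ 2 * sqenorm D <= 2 * (eta * (eta ^+ 2 * L ^+ 2)) * sqenorm g'.
  apply: (le_trans (ler_wpM2l (exprn_ge0 2 (ltW eta_gt0)) h2)).
  have -> : eta ^+ 2 * (L ^+ 2 * (2 * u * eta * sqenorm g')) =
     u * (2 * (eta * (eta ^+ 2 * L ^+ 2)) * sqenorm g') by ring.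
  by rewrite ler_piMl// mulr_ge0 ?sqenorm_ge0// mulr_ge0.
have h6 : sqenorm (Num.sqrt (2 * eta) *: g - eta *: D) <=
    M * (sqenorm g + sqenorm g').
  apply: (le_trans h3); rewrite /M.
  have : 0 <= eta * sqenorm g' by rewrite mulr_ge0 ?sqenorm_ge0// ltW.
  have : 0 <= eta * (eta ^+ 2 * L ^+ 2) * sqenorm g.
    by rewrite mulr_ge0 ?sqenorm_ge0.
  lra.
have := ler_wpM2l C0 h6; lra.
Qed.

End drift.

(** * Integration against the image of a measure under a kernel *)

Section kact_integral.
Context d d' (X : measurableType d) (Y : measurableType d') (R : realType).
Variables (mu : probability X R) (k : R.-pker X ~> Y).
Local Open Scope ereal_scope.
Import HBNNSimple.

Let integral_kact_nnsfun (h : {nnsfun Y >-> R}) :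
  \int[kact mu k]_y (h y)%:E = \int[mu]_x \int[k x]_y (h y)%:E.
Proof.
under [RHS]eq_integral do rewrite integralT_nnsfun sintegralE.
rewrite integralT_nnsfun sintegralE ge0_integral_fsum//; last 2 first.
- by move=> r; apply: measurable_funeM; exact: measurable_kernel.
- move=> r x _; have := mulemu_ge0 (fun n => h @^-1` [set n]).
  by apply; exact: preimage_nnfun0.
apply: eq_fsbigr => r _.
have [r0|r0] := leP 0%R r.
  by rewrite ge0_integralZl//; exact: measurable_kernel.
rewrite preimage_nnfun0// measure0 mule0.
by apply/esym/integral0_eq => x _; rewrite measure0 mule0.
Qed.

Lemma integral_kact (f : Y -> \bar R) : (forall y, 0 <= f y) ->
  measurable_fun setT f ->
  \int[kact mu k]_y f y = \int[mu]_x \int[k x]_y f y.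
Proof.
move=> f0 mf; pose f_ := nnsfun_approx measurableT mf.
have cvgf (m : {measure set Y -> \bar R}) :
    \int[m]_y f y = limn (fun n => \int[m]_y (f_ n y)%:E).
  rewrite -monotone_convergence//=.
  - apply: eq_integral => y _; apply/esym/cvg_lim => //.
    exact: cvg_nnsfun_approx.
  - by move=> n; exact/measurable_EFinP/measurable_funTS.
  - by move=> n y _; rewrite lee_fin.
  - by move=> y _ a b ab; rewrite lee_fin; exact/lefP/nd_nnsfun_approx.
have mk n : measurable_fun setT (fun x => \int[k x]_y (f_ n y)%:E).
  apply: measurable_fun_integral_kernel => //; first exact: measurable_kernel.
    by move=> y; rewrite lee_fin.
  exact/measurable_EFinP/measurable_funTS.
transitivity (limn (fun n => \int[kact mu k]_y (f_ n y)%:E)).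
  exact: cvgf.
rewrite (_ : (fun n => \int[kact mu k]_y _) =
    fun n => \int[mu]_x \int[k x]_y (f_ n y)%:E);
  last by apply/funext => n; exact: integral_kact_nnsfun.
rewrite -monotone_convergence//=.
- by apply: eq_integral => x _; rewrite -cvgf.
- by move=> n x _; apply: integral_ge0 => y _; rewrite lee_fin.
- move=> x _ a b ab; apply: ge0_le_integral => //=.
  + by move=> y _; rewrite lee_fin.
  + exact/measurable_EFinP/measurable_funTS.
  + exact/measurable_EFinP/measurable_funTS.
  + by move=> y _; rewrite lee_fin; exact/lefP/nd_nnsfun_approx.
Qed.

End kact_integral.

Lemma ge0_le_scale_integral d (X : measurableType d) (R : realType)
    (nu mu : {measure set X -> \bar R}) (a : R) (f : X -> \bar R) :
  0 <= a -> (forall A, measurable A -> (a%:E * nu A <= mu A)%E) ->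
  (forall x, (0 <= f x)%E) -> measurable_fun setT f ->
  (a%:E * \int[nu]_x f x <= \int[mu]_x f x)%E.
Proof.
move=> a0 h f0 mf.
have := @ge0_integral_mscale _ X R nu setT measurableT (NngNum a0) f mf
  (fun t _ => f0 t).
by move=> /= <-; exact: ge0_le_measure_integral.
Qed.

(** * Functions dominated by a weight *)

Section dominated_by_weight.
Context d (X : measurableType d) (R : realType).
Variable V : X -> R.
Hypotheses (V_ge0 : forall x, 0 <= V x) (mV : measurable_fun setT V).
Implicit Types (f g : X -> R).

(** The functions with finite [V]-norm: they are integrable against every
    probability measure integrating [V], and a kernel with a drift condition on
    [V] maps them to functions of the same kind. *)
Definition wbounded f : Prop :=
  measurable_fun setT f /\ exists b : R, forall x, `|f x| <= b * (1 + V x).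

Lemma wbounded_bound f : wbounded f ->
  exists2 b : R, 0 <= b & forall x, `|f x| <= b * (1 + V x).
Proof.
move=> [_ [b hb]]; exists `|b| => // x; apply: (le_trans (hb x)).
by rewrite ler_wpM2r ?ler_norm// addr_ge0.
Qed.

Lemma wbounded_weight : wbounded V.
Proof.
split => //; exists 1 => x.
by rewrite mul1r ger0_norm// lerDr.
Qed.

Lemma wbounded_cst (c : R) : wbounded (cst c).
Proof.
split => //; exists `|c| => x /=.
by rewrite ler_peMr// lerDl.
Qed.

Lemma wboundedZ (c : R) f : wbounded f -> wbounded (fun x => c * f x).
Proof.
move=> [mf [b hb]]; split; first exact: measurable_funM.
by exists (`|c| * b) => x; rewrite normrM -mulrA ler_wpM2l.
Qed.

Lemma wboundedD f g : wbounded f -> wbounded g ->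
  wbounded (fun x => f x + g x).
Proof.
move=> [mf [b hb]] [mg [c hc]]; split; first exact: measurable_funD.
exists (b + c) => x; rewrite mulrDl.
by apply: (le_trans (ler_normD _ _)); rewrite lerD.
Qed.

Lemma wboundedB f g : wbounded f -> wbounded g ->
  wbounded (fun x => f x - g x).
Proof.
move=> [mf [b hb]] [mg [c hc]]; split; first exact: measurable_funB.
exists (b + c) => x; rewrite mulrDl.
by apply: (le_trans (ler_normB _ _)); rewrite lerD.
Qed.

Variable mu : {measure set X -> \bar R}.
Hypotheses (mu1 : mu setT = 1%E) (Vint : (\int[mu]_x (V x)%:E < +oo)%E).

Lemma integrable_wbounded f : wbounded f -> mu.-integrable setT (EFin \o f).
Proof.
move=> wf; have [b b0 hb] := wbounded_bound wf; case: wf => mf _.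
have iV : mu.-integrable setT (EFin \o V).
  apply/integrableP; split; first exact/measurable_EFinP.
  by under eq_integral => x _ do rewrite /= ger0_norm//.
have ic : mu.-integrable setT (EFin \o cst 1).
  apply/integrableP; split; first exact/measurable_EFinP.
  under eq_integral => x _ do rewrite /= normr1.
  by rewrite integral_cst//= mu1 mule1 ltry.
apply: (le_integrable measurableT _ _
  (integrableZl measurableT b (integrableD measurableT ic iV))).
  exact/measurable_EFinP.
move=> x _ /=; rewrite lee_fin (le_trans (hb x))//.
by rewrite ger0_norm// mulr_ge0// addr_ge0.
Qed.

Lemma Rintegral_cst1 (c : R) : (\int[mu]_x c)%R = c.
Proof. by rewrite Rintegral_cst// mu1 mulr1. Qed.

Lemma Rintegral_affine (a b : R) :
  (\int[mu]_x (a + b * V x))%R = a + b * (\int[mu]_x V x)%R.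
Proof.
rewrite RintegralD//; last 2 first.
- exact: integrable_wbounded (wbounded_cst a).
- exact: integrable_wbounded (wboundedZ b wbounded_weight).
rewrite Rintegral_cst1 RintegralZl//.
exact: integrable_wbounded wbounded_weight.
Qed.

Lemma wbounded_le_affine f (a b : R) : wbounded f ->
  (forall x, f x <= a + b * V x) ->
  (\int[mu]_x f x)%R <= a + b * (\int[mu]_x V x)%R.
Proof.
move=> wf h; rewrite -Rintegral_affine le_Rintegral//.
- exact: integrable_wbounded.
- apply: integrable_wbounded; apply: (wboundedD (wbounded_cst a)).
  exact: wboundedZ wbounded_weight.
Qed.

Lemma EFin_Rintegral f : wbounded f ->
  ((\int[mu]_x f x)%R%:E = \int[mu]_x (f x)%:E)%E.
Proof.
move=> wf; rewrite fineK//; apply: integrable_fin_num => //.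
exact: integrable_wbounded.
Qed.

End dominated_by_weight.

(** * Transition operators with a Lyapunov function *)

Section lyapunov.
Context d (X : measurableType d) (R : realType).
Variables (Q : R.-pker X ~> X) (V : X -> R) (lam K : R).
Hypotheses (V_ge0 : forall x, 0 <= V x) (mV : measurable_fun setT V).
Hypotheses (lam_ge0 : 0 <= lam) (K_ge0 : 0 <= K).
Hypothesis drift :
  forall x, (\int[Q x]_y (V y)%:E <= (lam * V x + K)%:E)%E.
Implicit Types (phi : X -> R) (mu : probability X R).

Definition kop phi (x : X) : R := \int[Q x]_y phi y.

Let mVe : measurable_fun setT (fun x => (V x)%:E).
Proof. exact/measurable_EFinP. Qed.

Let Q1 x : Q x setT = 1%E. Proof. exact: prob_kernel. Qed.

Let QV x : (\int[Q x]_y (V y)%:E < +oo)%E.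
Proof. by apply: le_lt_trans (drift x) _; rewrite ltry. Qed.

Lemma kop_weight_le x : kop V x <= lam * V x + K.
Proof.
rewrite -lee_fin (EFin_Rintegral V_ge0 mV (Q1 x) (QV x))//.
exact: wbounded_weight.
Qed.

Lemma kop_le phi (a b : R) x : wbounded V phi ->
  (forall y, phi y <= a + b * V y) -> kop phi x <= a + b * kop V x.
Proof. by move=> wp h; apply: wbounded_le_affine. Qed.

Lemma kopN phi x : wbounded V phi -> kop (fun y => - phi y) x = - kop phi x.
Proof.
move=> wp; rewrite /kop; under eq_Rintegral do rewrite -mulN1r.
rewrite RintegralZl ?mulN1r//.
exact: integrable_wbounded wp.
Qed.

Lemma kop_shift phi (a : R) x : wbounded V phi ->
  kop (fun y => phi y + a) x = kop phi x + a.
Proof.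
move=> wp; rewrite /kop RintegralD//; last 2 first.
- exact: integrable_wbounded wp.
- exact: integrable_wbounded (wbounded_cst _ a).
by congr (_ + _); exact: Rintegral_cst1.
Qed.

Let kop_split phi b x : wbounded V phi ->
  kop phi x = kop (fun y => phi y + b * (1 + V y)) x -
              kop (fun y => b * (1 + V y)) x.
Proof.
move=> wp; rewrite /kop -RintegralB//.
- by apply: eq_Rintegral => y _; rewrite addrK.
- apply: (integrable_wbounded V_ge0) => //; apply: wboundedD => //.
  apply: wboundedZ; apply: (wboundedD (wbounded_cst _ 1)) => //.
  exact: wbounded_weight.
- apply: (integrable_wbounded V_ge0) => //.
  apply: wboundedZ; apply: (wboundedD (wbounded_cst _ 1)) => //.
  exact: wbounded_weight.
Qed.

Let measurable_kop_ge0 phi : measurable_fun setT phi ->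
  (forall x, 0 <= phi x) -> measurable_fun setT (kop phi).
Proof.
move=> mp p0; apply: (measurableT_comp (@fine_measurable R setT measurableT)).
apply: measurable_fun_integral_kernel.
- exact: measurable_kernel.
- by move=> y; rewrite lee_fin.
- exact/measurable_EFinP.
Qed.

Lemma wbounded_kop phi : wbounded V phi -> wbounded V (kop phi).
Proof.
move=> wp; have [b b0 hb] := wbounded_bound V_ge0 wp; split.
  have -> : kop phi = fun x => kop (fun y => phi y + b * (1 + V y)) x -
              kop (fun y => b * (1 + V y)) x.
    by apply/funext => x; rewrite -kop_split.
  have mb : measurable_fun setT (fun y => b * (1 + V y)).
    by apply: measurable_funM => //; exact: measurable_funD.
  apply: measurable_funB; apply: measurable_kop_ge0 => //.
  - by apply: measurable_funD => //; case: wp.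
  - move=> y; have := hb y; rewrite ler_norml => /andP[+ _]; lra.
  - by move=> y; rewrite mulr_ge0// addr_ge0.
exists (b * (1 + lam + K)) => x.
have h1 : kop phi x <= b + b * kop V x.
  apply: kop_le => // y; have := hb y; rewrite ler_norml => /andP[_]; lra.
have h2 : - kop phi x <= b + b * kop V x.
  rewrite -kopN//; apply: kop_le => [|y].
    have -> : (fun y => - phi y) = fun y => - 1 * phi y.
      by apply/funext => y; rewrite mulN1r.
    exact: wboundedZ.
  have := hb y; rewrite ler_norml => /andP[+ _]; lra.
have h3 : b * kop V x <= b * (lam * V x + K).
  by rewrite ler_wpM2l// kop_weight_le.
have h4 : b * (lam * V x + K) + b <= b * (1 + lam + K) * (1 + V x).
  rewrite -subr_ge0.
  have -> : b * (1 + lam + K) * (1 + V x) - (b * (lam * V x + K) + b) =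
    b * lam + b * V x + b * K * V x by ring.
  by rewrite !addr_ge0// !mulr_ge0.
rewrite ler_norml; apply/andP; split; lra.
Qed.

Lemma integral_kact_weight mu :
  (\int[kact mu Q]_y (V y)%:E <= lam%:E * \int[mu]_x (V x)%:E + K%:E)%E.
Proof.
rewrite integral_kact//.
have mlV : measurable_fun setT (fun x => lam%:E * (V x)%:E)%E.
  exact: measurable_funeM mVe.
apply: (@le_trans _ _ (\int[mu]_x (lam%:E * (V x)%:E + K%:E))%E).
  apply: ge0_le_integral => //.
  - by move=> x _; apply: integral_ge0 => y _; rewrite lee_fin.
  - apply: measurable_fun_integral_kernel => //.
    exact: measurable_kernel.
  - exact: emeasurable_funD.
rewrite ge0_integralD//; last first.
  by move=> x _; rewrite -EFinM lee_fin mulr_ge0.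
rewrite ge0_integralZl//; last by move=> x _; rewrite lee_fin.
by rewrite integral_cst//= probability_setT mule1.
Qed.

Lemma kact_weight_lty mu : (\int[mu]_x (V x)%:E < +oo)%E ->
  (\int[kact mu Q]_x (V x)%:E < +oo)%E.
Proof.
move=> h; apply: le_lt_trans (integral_kact_weight mu) _.
rewrite lte_add_pinfty ?ltry// lte_mul_pinfty//.
Qed.

Lemma kiter_weight_lty mu n : (\int[mu]_x (V x)%:E < +oo)%E ->
  (\int[kiter Q mu n]_x (V x)%:E < +oo)%E.
Proof. by move=> h; elim: n => //= n; exact: kact_weight_lty. Qed.

Lemma kiter_weight_le mu n (M : R) : lam * M + K <= M ->
  (\int[mu]_x (V x)%:E <= M%:E)%E ->
  (\int[kiter Q mu n]_x (V x)%:E <= M%:E)%E.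
Proof.
move=> hM h; elim: n => //= n IH; apply: (le_trans (integral_kact_weight _)).
apply: (@le_trans _ _ (lam%:E * M%:E + K%:E)%E).
  by rewrite leeD2r// lee_wpmul2l// lee_fin.
by rewrite -EFinM -EFinD lee_fin.
Qed.

(** The formula holds for nonnegative functions; a function bounded by
    [b (1 + V)] is the difference of two nonnegative ones. *)
Lemma Rintegral_kact mu phi : (\int[mu]_x (V x)%:E < +oo)%E ->
  wbounded V phi ->
  \int[kact mu Q]_x phi x = \int[mu]_x kop phi x.
Proof.
move=> hmu wp.
have ge0case f : wbounded V f -> (forall x, 0 <= f x) ->
    \int[kact mu Q]_x f x = \int[mu]_x kop f x.
  move=> wf f0; rewrite /Rintegral integral_kact//; last first.
    by apply/measurable_EFinP; case: wf.
  congr fine; apply: eq_integral => x _.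
  by rewrite (EFin_Rintegral V_ge0 mV).
have [b b0 hb] := wbounded_bound V_ge0 wp.
have wb : wbounded V (fun y => b * (1 + V y)).
  apply: wboundedZ; apply: (wboundedD (wbounded_cst _ 1)) => //.
  exact: wbounded_weight.
have b1 y : 0 <= b * (1 + V y) by rewrite mulr_ge0// addr_ge0.
have wpb := wboundedD wp wb.
have pb0 y : 0 <= phi y + b * (1 + V y).
  have := hb y; rewrite ler_norml => /andP[+ _]; lra.
have hk := kact_weight_lty hmu.
transitivity (\int[kact mu Q]_x (phi x + b * (1 + V x)) -
    \int[kact mu Q]_x (b * (1 + V x))).
  rewrite -RintegralB//.
  - by apply: eq_Rintegral => x _; rewrite addrK.
  - by apply: (integrable_wbounded V_ge0) => //; exact: probability_setT.
  - by apply: (integrable_wbounded V_ge0) => //; exact: probability_setT.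
rewrite !ge0case// -RintegralB//.
- by apply: eq_Rintegral => x _; rewrite -kop_split.
- apply: (integrable_wbounded V_ge0) => //; last exact: wbounded_kop.
  exact: probability_setT.
- apply: (integrable_wbounded V_ge0) => //; last exact: wbounded_kop.
  exact: probability_setT.
Qed.

Lemma wbounded_iter_kop phi n : wbounded V phi -> wbounded V (iter n kop phi).
Proof. by move=> wp; elim: n => //= n; exact: wbounded_kop. Qed.

Lemma Rintegral_kiter mu phi n : (\int[mu]_x (V x)%:E < +oo)%E ->
  wbounded V phi ->
  \int[kiter Q mu n]_x phi x = \int[mu]_x iter n kop phi x.
Proof.
move=> hmu; elim: n phi => [|n IH] phi wp //=.
rewrite Rintegral_kact//; last exact: kiter_weight_lty.
rewrite IH; last exact: wbounded_kop.
by rewrite -iterSr.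
Qed.

End lyapunov.

(** * Harris' theorem: contraction *)

Section contraction.
Context d (X : measurableType d) (R : realType).
Variables (Q : R.-pker X ~> X) (V : X -> R) (lam K : R).
Hypotheses (V_ge0 : forall x, 0 <= V x) (mV : measurable_fun setT V).
Hypotheses (lam_ge0 : 0 <= lam) (lam_lt1 : lam < 1) (K_ge0 : 0 <= K).
Hypothesis drift :
  forall x, (\int[Q x]_y (V y)%:E <= (lam * V x + K)%:E)%E.
Implicit Types (phi : X -> R) (mu : probability X R).

Let Q1 x : Q x setT = 1%E. Proof. exact: prob_kernel. Qed.

Let QV x : (\int[Q x]_y (V y)%:E < +oo)%E.
Proof. by apply: le_lt_trans (drift x) _; rewrite ltry. Qed.

(** The oscillation seminorm dual to the distance of Hairer and Mattingly. *)
Definition wosc (beta c : R) phi : Prop :=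
  forall x y, phi x - phi y <= c * (2 + beta * V x + beta * V y).

Lemma wosc_wbounded beta c phi : 0 <= beta -> 0 <= c ->
  measurable_fun setT phi -> wosc beta c phi -> wbounded V phi.
Proof.
move=> b0 c0 mp h; split => //; pose z : X := point.
exists (`|phi z| + c * (2 + beta + beta * V z)) => x.
have h1 := h x z; have h2 := h z x.
have n1 := ler_norm (phi z); have n2 := ler_norm (- phi z).
rewrite normrN in n2.
have p1 : 0 <= `|phi z| * V x by rewrite mulr_ge0.
have p2 : 0 <= c * V x by rewrite mulr_ge0.
have p3 : 0 <= c * beta by rewrite mulr_ge0.
have p4 : 0 <= c * beta * V z * V x by rewrite !mulr_ge0.
by rewrite ler_norml; apply/andP; split; nra.
Qed.

(** The component [al * nu] common to both transition measures cancels in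
    [Q phi x - Q phi y]: apply the domination to the nonnegative functions
    [c (1 + beta V) - phi] at [x] and [c (1 + beta V) + phi] at [y]. *)
Lemma kop_minorized (beta c al : R) phi (nu : probability X R) x y :
  0 <= beta -> 0 <= c -> 0 < al ->
  (forall A, measurable A -> (al%:E * nu A <= Q x A)%E) ->
  (forall A, measurable A -> (al%:E * nu A <= Q y A)%E) ->
  measurable_fun setT phi -> (forall z, `|phi z| <= c * (1 + beta * V z)) ->
  kop Q phi x - kop Q phi y <=
    c * (2 - 2 * al + beta * (kop Q V x + kop Q V y)).
Proof.
move=> b0 c0 al0 hx hy mp hphi.
have minor (f : X -> R) z : measurable_fun setT f -> (forall t, 0 <= f t) ->
    (forall A, measurable A -> (al%:E * nu A <= Q z A)%E) ->
    (al%:E * \int[nu]_t (f t)%:E <= \int[Q z]_t (f t)%:E)%E.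
  move=> mf f0 hz; apply: ge0_le_scale_integral => //; first exact: ltW.
  exact/measurable_EFinP.
have nuV : (\int[nu]_t (V t)%:E < +oo)%E.
  have := le_lt_trans (minor _ _ mV V_ge0 hx) (QV x).
  have : (0 <= \int[nu]_t (V t)%:E)%E.
    by apply: integral_ge0 => t _; rewrite lee_fin.
  case: (\int[nu]_t (V t)%:E)%E => [r _ _|_|//].
    by rewrite ltry.
  by rewrite gt0_muley// lte_fin.
have wp : wbounded V phi.
  split => //; exists (c * (1 + beta)) => z; apply: (le_trans (hphi z)).
  rewrite -mulrA ler_wpM2l//.
  have : 0 <= beta * V z by rewrite mulr_ge0.
  have := V_ge0 z; lra.
have w1 : wbounded V (fun t => c + c * beta * V t).
  apply: (wboundedD (wbounded_cst _ c)) => //.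
  exact: wboundedZ (wbounded_weight V_ge0 mV).
have [w wE] : exists w : X -> R, w = fun t => c + c * beta * V t by eexists.
rewrite -wE in w1.
have nu1 : nu setT = 1%E by exact: probability_setT.
have Rminor (f : X -> R) z : wbounded V f -> (forall t, 0 <= f t) ->
    (forall A, measurable A -> (al%:E * nu A <= Q z A)%E) ->
    al * \int[nu]_t f t <= \int[Q z]_t f t.
  move=> wf f0 hz; rewrite -lee_fin EFinM.
  rewrite (EFin_Rintegral V_ge0 mV nu1 nuV wf).
  rewrite (EFin_Rintegral V_ge0 mV (Q1 z) (QV z) wf).
  by apply: minor => //; case: wf.
have affE (m : {measure set X -> \bar R}) : m setT = 1%E ->
    (\int[m]_t (V t)%:E < +oo)%E ->
    \int[m]_t w t = c + c * beta * \int[m]_t V t.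
  by move=> m1 mfin; rewrite wE (Rintegral_affine V_ge0 mV m1 mfin).
have h1 := Rminor _ x (wboundedB w1 wp) _ hx.
have h2 := Rminor _ y (wboundedD w1 wp) _ hy.
have nn t : - w t <= phi t <= w t.
  by rewrite wE; have := hphi t; rewrite ler_norml mulrDr mulr1 mulrA.
have w_ge t : 0 <= w t - phi t by rewrite subr_ge0; case/andP: (nn t).
have w_ge' t : 0 <= w t + phi t.
  by rewrite addrC -[w t]opprK subr_ge0; case/andP: (nn t).
move: {h1 h2}(h1 w_ge) (h2 w_ge'); rewrite !RintegralB ?RintegralD//; last 8 first.
1-8: by apply: (integrable_wbounded V_ge0 mV).
rewrite !affE// /kop.
set N := \int[nu]_t V t; set P := \int[nu]_t phi t => h1 h2.
have N0 : 0 <= N by apply: Rintegral_ge0.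
have : 0 <= 2 * al * c * beta * N by rewrite !mulr_ge0// ltW.
lra.
Qed.

Hypothesis minorization : forall r : R, exists (al : R) (nu : probability X R),
  0 < al /\ forall x, V x <= r ->
    forall A, measurable A -> (al%:E * nu A <= Q x A)%E.

(** Up to an additive constant, an oscillation bound is a bound on the function
    itself; the constant is the largest one compatible with the upper bound. *)
Let shift_exists beta c phi : 0 <= beta -> 0 <= c -> wosc beta c phi ->
  exists a : R, forall z, `|phi z + a| <= c * (1 + beta * V z).
Proof.
move=> b0 c0 h.
pose S := [set c * (1 + beta * V z) - phi z | z in [set: X]].
have lbS y : lbound S (- (phi y + c * (1 + beta * V y))).
  by move=> _ [z _ <-]; have := h z y; lra.
have infS : has_inf S.
  split; first by exists (c * (1 + beta * V point) - phi point); exists point.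
  by exists (- (phi point + c * (1 + beta * V point))).
exists (inf S) => z; rewrite ler_norml; apply/andP; split.
  have : - (phi z + c * (1 + beta * V z)) <= inf S.
    by apply: lb_le_inf; [case: infS|exact: lbS].
  lra.
have : inf S <= c * (1 + beta * V z) - phi z.
  by apply: ge_inf; [case: infS|exists z].
lra.
Qed.

(** Adding a constant to [phi], assume [|phi| <= c (1 + beta V)]. If [V x + V y]
    is large, the drift alone gives a contraction of the weight; otherwise both
    points are in a sublevel set, where the minorization removes [2 al] from
    the constant part of the weight, while a small [beta] keeps the contribution
    of [K] below [al]. *)
Lemma kop_contraction : exists beta rho : R,
  [/\ 0 < beta, beta <= 1, 0 < rho, rho < 1 &
    forall phi c, 0 <= c -> measurable_fun setT phi -> wosc beta c phi ->
      wosc beta (rho * c) (kop Q phi)].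
Proof.
(* Beyond [r0], half of the decrease [(1 - lam) (V x + V y)] covers [2 K]. *)
pose r0 := 4 * K / (1 - lam) + 1.
have l1 : 0 < 1 - lam by rewrite subr_gt0.
have r0K : 4 * K <= (1 - lam) * r0.
  by rewrite /r0 mulrDr mulr1 [X in X + _]mulrC divfK ?gt_eqF//; lra.
have r01 : 1 <= r0 by rewrite /r0 lerDr divr_ge0 ?mulr_ge0// ltW.
have [al [nu [al0 hmin]]] := minorization r0.
pose beta := Num.min 1 (al / (2 * K + 1)).
have b1 : beta <= 1 by rewrite ge_min lexx.
have K0 := K_ge0.
have b0 : 0 < beta.
  rewrite lt_min ltr01/= divr_gt0//.
  by rewrite ltr_wpDl// mulr_ge0.
have bK : 2 * (beta * K) <= al.
  have : beta <= al / (2 * K + 1) by rewrite ge_min lexx orbT.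
  rewrite ler_pdivlMr; last lra.
  by lra.
(* [rho3], the rate far from the centre, is the supremum over [s >= r0] of
   [(2 + beta * g * s) / (2 + beta * s)]. *)
pose g := (1 + lam) / 2.
pose rho3 := (2 + beta * g * r0) / (2 + beta * r0).
have br0 : 0 < beta * r0 by rewrite mulr_gt0//; lra.
have g0 : 0 <= g by rewrite divr_ge0// addr_ge0.
have bg : 0 <= beta * g * r0.
  by rewrite mulr_ge0 ?(le_trans ler01 r01)// mulr_ge0// ltW.
have rho3_gt0 : 0 < rho3 by rewrite /rho3 divr_gt0//; lra.
have rho3_lt1 : rho3 < 1.
  rewrite /rho3 ltr_pdivrMr; last lra.
  rewrite mul1r ltrD2l mulrAC gtr_pMr// /g; lra.
pose rho := Num.max rho3 (Num.max (1 - al / 2) lam).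
exists beta, rho; split => //.
- by rewrite lt_max rho3_gt0.
- by rewrite !gt_max rho3_lt1 lam_lt1 andbT/=; lra.
move=> phi c c0 mp osc x y.
have wp := wosc_wbounded (ltW b0) c0 mp osc.
have [a ha] := shift_exists (ltW b0) c0 osc.
have mpa : measurable_fun setT (fun z => phi z + a) by exact: measurable_funD.
have wpa : wbounded V (fun z => phi z + a).
  exact: wboundedD wp (wbounded_cst _ a).
have -> : kop Q phi x - kop Q phi y =
    kop Q (fun z => phi z + a) x - kop Q (fun z => phi z + a) y.
  by rewrite !(kop_shift V_ge0 mV drift)//; ring.
have Wx := kop_weight_le V_ge0 mV drift x.
have Wy := kop_weight_le V_ge0 mV drift y.
have s0 : 0 <= V x + V y by rewrite addr_ge0.
have cb0 : 0 <= c * beta by rewrite mulr_ge0// ltW.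
set s := V x + V y in s0.
have goalE : rho * c * (2 + beta * V x + beta * V y) =
    c * (rho * (2 + beta * s)).
  by rewrite /s; ring.
rewrite goalE.
have bW : beta * (kop Q V x + kop Q V y) <= beta * (lam * s + 2 * K).
  by rewrite ler_wpM2l ?(ltW b0)// /s; lra.
have bs0 : 0 <= beta * s by rewrite mulr_ge0// ltW.
have [sr|sr] := leP s r0.
- have Vx : V x <= r0 by apply: le_trans sr; rewrite lerDl.
  have Vy : V y <= r0 by apply: le_trans sr; rewrite lerDr.
  apply: (le_trans
    (kop_minorized (ltW b0) c0 al0 (hmin x Vx) (hmin y Vy) mpa ha)).
  rewrite ler_wpM2l//.
  have r1 : 1 - al / 2 <= rho by rewrite !le_max lexx orbT.
  have r2 : lam <= rho by rewrite !le_max lexx !orbT.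
  have := ler_wpM2r bs0 r2; lra.
- have h1 : kop Q (fun z => phi z + a) x <= c + c * beta * kop Q V x.
    apply: (kop_le V_ge0 mV drift) => // z.
    by have := ha z; rewrite ler_norml => /andP[_]; lra.
  have h2 : - kop Q (fun z => phi z + a) y <= c + c * beta * kop Q V y.
    rewrite -(kopN V_ge0 mV drift)//.
    apply: (kop_le V_ge0 mV drift) => [|z].
      have -> : (fun z => - (phi z + a)) = fun z => - 1 * (phi z + a).
        by apply/funext => z; rewrite mulN1r.
      exact: wboundedZ.
    by have := ha z; rewrite ler_norml => /andP[+ _]; lra.
  have h3 : c * (2 + beta * (kop Q V x + kop Q V y)) <=
      c * (2 + beta * (lam * s + 2 * K)).
    by rewrite ler_wpM2l// lerD2l.
  apply: (@le_trans _ _ (c * (2 + beta * (lam * s + 2 * K)))); first lra.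
  rewrite ler_wpM2l//.
  have h4 : beta * (lam * s + 2 * K) <= beta * g * s.
    rewrite -mulrA ler_wpM2l ?(ltW b0)// /g.
    have : (1 - lam) * r0 <= (1 - lam) * s by rewrite ler_wpM2l ?(ltW l1)// ltW.
    lra.
  apply: (@le_trans _ _ (2 + beta * g * s)); first lra.
  have r3 : rho3 <= rho by rewrite !le_max lexx.
  apply: (@le_trans _ _ (rho3 * (2 + beta * s))); last first.
    by rewrite ler_wpM2r//; lra.
  rewrite /rho3 [leRHS]mulrAC ler_pdivlMr; last lra.
  have : 0 <= 2 * beta * (1 - g) * (s - r0).
    rewrite !mulr_ge0//; [exact: ltW|rewrite /g; lra|lra].
  lra.
Qed.

End contraction.

(** * Setwise limits of probability measures *)

Section setwise_limit.
Context d (X : measurableType d) (R : realType).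
Implicit Types (mus : nat -> probability X R) (A : set X).

(** Exchange of the limits in [n] (the measures) and in the number of sets of a
    disjoint union, allowed by uniformity over the sets. *)
Lemma uniform_cauchy_probability mus (e : nat -> R) : e @ \oo --> 0 ->
  (forall n k A, measurable A ->
    `|fine (mus (n + k)%N A) - fine (mus n A)| <= e n) ->
  exists pi : probability X R,
    forall A, measurable A -> mus ^~ A @ \oo --> pi A.
Proof.
move=> e0 he.
have esmall (eps : R) : 0 < eps -> exists n, e n < eps.
  move=> eps0; move/cvgrPdist_lt : e0 => /(_ _ eps0)[N _ /(_ N (leqnn N))] /=.
  by rewrite sub0r normrN => h; exists N; apply: le_lt_trans h; exact: ler_norm.
pose p A : R := lim ((fun n => fine (mus n A)) @ \oo).
have pcvg A : measurable A -> (fun n => fine (mus n A)) @ \oo --> p A.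
  move=> mA; apply/cauchy_cvgP/cauchy_exP => eps eps0.
  have [N hN] := esmall _ eps0.
  exists (fine (mus N A)); exists N => // n /= Nn.
  rewrite -ball_normE /ball_/= distrC (le_lt_trans _ hN)//.
  by rewrite -(subnKC Nn) he.
have pe n A : measurable A -> `|p A - fine (mus n A)| <= e n.
  move=> mA; apply/ler_addgt0Pr => eps eps0.
  move/cvgrPdist_lt : (pcvg A mA) => /(_ _ eps0)[N _].
  move=> /(_ (n + N)%N (leq_addl _ _)) /=.
  move=> h; rewrite (le_trans (ler_distD (fine (mus (n + N)%N A)) _ _))// addrC.
  by rewrite lerD// ?he// ltW.
have mfin n A : measurable A -> mus n A \is a fin_num by exact: fin_num_measure.
(* A measure must be nonnegative on all sets, while the limit is controlled on
   the measurable ones: set it to 0 elsewhere. *)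
pose pm A : \bar R := if `[< measurable A >] then (p A)%:E else 0%E.
have pmE A : measurable A -> pm A = (p A)%:E.
  by move=> mA; rewrite /pm; case: asboolP.
have mcvg A : measurable A -> mus ^~ A @ \oo --> pm A.
  move=> mA; rewrite pmE//.
  have -> : mus ^~ A = EFin \o (fun n => fine (mus n A)).
    by apply/funext => n /=; rewrite fineK// mfin.
  by apply: cvg_EFin; [exact: nearW|exact: pcvg].
have pm0 : pm set0 = 0%E.
  have := mcvg _ (@measurable0 _ X).
  under eq_cvg do rewrite measure0.
  move=> h; apply: (cvg_unique (@ereal_hausdorff R) h); exact: cvg_cst.
have pmT : pm setT = 1%E.
  have := mcvg _ (@measurableT _ X).
  under eq_cvg do rewrite probability_setT.
  move=> h; apply: (cvg_unique (@ereal_hausdorff R) h); exact: cvg_cst.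
have pm_ge0 A : (0 <= pm A)%E.
  rewrite /pm; case: asboolP => // mA; rewrite lee_fin.
  apply: limr_ge; first exact/cvg_ex/(ex_intro _ (p A))/pcvg.
  by apply: nearW => n; exact: fine_ge0.
have pm_add : semi_sigma_additive pm.
  move=> F mF tF mUF.
  have fadd n : (\sum_(0 <= i < n) pm (F i) =
      pm (\big[setU/set0]_(i < n) F i))%E.
    have mU : measurable (\big[setU/set0]_(i < n) F i).
      exact: bigsetU_measurable.
    have := mcvg _ mU; under eq_cvg.
      by move=> k; rewrite measure_semi_additive//; over.
    move=> h; apply: (cvg_unique (@ereal_hausdorff R) _ h).
    rewrite big_mkord; apply: cvg_nnesum => i _; first exact: nearW.
    exact: mcvg.
  rewrite (_ : (fun n => _) = fun n => pm (\big[setU/set0]_(i < n) F i));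
    last by apply/funext => n; exact: fadd.
  have mU n : measurable (\big[setU/set0]_(i < n) F i).
    exact: bigsetU_measurable.
  rewrite pmE// (_ : (fun n => _) = EFin \o
      (fun n => p (\big[setU/set0]_(i < n) F i)));
    last by apply/funext => n; exact: pmE.
  apply: cvg_EFin; first exact: nearW.
  apply/cvgrPdist_le => eps eps0.
  have eps3 : 0 < eps / 3 by rewrite divr_gt0.
  have [k hk] := esmall _ eps3.
  have : (fun n => mus k (\big[setU/set0]_(i < n) F i)) @ \oo -->
      (fine (mus k (\bigcup_n F n)))%:E.
    rewrite fineK ?mfin//.
    rewrite (_ : (fun n => _) = fun n => \sum_(0 <= i < n) mus k (F i))%E.
      exact: measure_semi_sigma_additive.
    by apply/funext => n; rewrite big_mkord measure_semi_additive.
  move=> /fine_cvg /cvgrPdist_lt /(_ _ eps3)[N _ hN].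
  exists N => // n /hN /= hn.
  have h1 := pe k _ mUF; have h2 := pe k _ (mU n).
  move: hn h1 h2; rewrite /comp !ler_norml !ltr_norml.
  move=> /andP[? ?] /andP[? ?] /andP[? ?]; apply/andP; split; lra.
pose pmm : {measure set X -> \bar R} :=
  HB.pack pm (isMeasure.Build _ _ _ pm pm0 pm_ge0 pm_add).
pose pi : probability X R :=
  HB.pack pm pmm (Measure_isProbability.Build _ _ _ pmm pmT).
by exists pi.
Qed.

Import HBNNSimple.

(** For a simple function the integrals converge; take the supremum over the
    simple functions below [f]. *)
Lemma setwise_fatou mus (pi : probability X R) (f : X -> \bar R) (B : \bar R) :
  (forall A, measurable A -> mus ^~ A @ \oo --> pi A) ->
  (forall x, (0 <= f x)%E) ->
  (\forall n \near \oo, (\int[mus n]_x f x <= B)%E) ->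
  (\int[pi]_x f x <= B)%E.
Proof.
move=> hpi f0 hB; rewrite ge0_integralTE//.
apply: ge_ereal_sup => _ [h hf <-].
have hs : (fun n => sintegral (mus n) h) @ \oo --> sintegral pi h.
  have sE (m : {measure set X -> \bar R}) : (sintegral m h =
      \sum_(r <- finmap.enum_fset (fset_set (range h)))
        r%:E * m (h @^-1` [set r]))%E.
    by rewrite sintegralE fsbig_finite.
  rewrite sE (_ : (fun n => _) = fun n =>
      (\sum_(r <- finmap.enum_fset (fset_set (range h)))
        r%:E * mus n (h @^-1` [set r]))%E);
    last by apply/funext => n; exact: sE.
  apply: cvg_nnesum => r _.
    apply: nearW => n; have := mulemu_ge0 (fun x => h @^-1` [set x]).
    by apply; exact: preimage_nnfun0.
  by apply: cvgeZl => //; exact: hpi.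
rewrite -(cvg_lim _ hs)//; apply: lime_le.
  by apply/cvg_ex; eexists; exact: hs.
near=> n; apply: (@le_trans _ _ (\int[mus n]_x f x)%E); last by near: n.
by rewrite ge0_integralTE//; apply: ereal_sup_ubound; exists h.
Unshelve. all: by end_near. Qed.

End setwise_limit.

(** * Harris' theorem: the invariant measure *)

Section harris.
Context d (X : measurableType d) (R : realType).
Variables (Q : R.-pker X ~> X) (V : X -> R) (lam K : R).
Hypotheses (V_ge0 : forall x, 0 <= V x) (mV : measurable_fun setT V).
Hypotheses (lam_ge0 : 0 <= lam) (lam_lt1 : lam < 1) (K_ge0 : 0 <= K).
Hypothesis drift :
  forall x, (\int[Q x]_y (V y)%:E <= (lam * V x + K)%:E)%E.
Implicit Types (phi : X -> R) (mu : probability X R) (A : set X).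

Lemma Rintegral_indic mu A : measurable A -> \int[mu]_x \1_A x = fine (mu A).
Proof. by move=> mA; rewrite /Rintegral integral_indic// setIT. Qed.

Lemma kiterD mu n k : kiter Q mu (n + k) = kiter Q (kiter Q mu k) n.
Proof. by elim: n => //= n ->. Qed.

Lemma invariant_kiter mu n A : invariant_measure Q mu -> measurable A ->
  kiter Q mu n A = mu A.
Proof.
move=> inv; elim: n A => // n IH A mA; rewrite -[RHS]inv//.
by apply: eq_measure_integral => B mB _; exact: IH.
Qed.

(** Averaging the pointwise bound against [mu1] and then [mu2] amounts to
    integrating it against the independent coupling. *)
Lemma Rintegral_wosc beta c phi mu1 mu2 :
  (\int[mu1]_x (V x)%:E < +oo)%E -> (\int[mu2]_x (V x)%:E < +oo)%E ->
  wbounded V phi -> wosc V beta c phi ->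
  \int[mu1]_x phi x - \int[mu2]_x phi x <=
    c * (2 + beta * \int[mu1]_x V x + beta * \int[mu2]_x V x).
Proof.
move=> f1 f2 wp h.
have t1 : mu1 setT = 1%E by exact: probability_setT.
have t2 : mu2 setT = 1%E by exact: probability_setT.
have h1 y : \int[mu1]_x phi x - c * (2 + beta * \int[mu1]_x V x)
     - c * beta * V y <= phi y.
  have hx x : phi x <= (phi y + c * (2 + beta * V y)) + c * beta * V x.
    by have := h x y; lra.
  by have := wbounded_le_affine V_ge0 mV t1 f1 wp hx; lra.
have h2 x : - 1 * phi x <=
    - (\int[mu1]_x phi x - c * (2 + beta * \int[mu1]_x V x)) + c * beta * V x.
  by have := h1 x; lra.
have := wbounded_le_affine V_ge0 mV t2 f2 (wboundedZ (-1) wp) h2.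
rewrite RintegralZl//; last exact: (integrable_wbounded V_ge0 mV).
lra.
Qed.

Variables (beta rho : R).
Hypotheses (beta_gt0 : 0 < beta) (beta_le1 : beta <= 1) (rho_gt0 : 0 < rho)
  (rho_lt1 : rho < 1).
Hypothesis kop_wosc : forall phi c, 0 <= c -> measurable_fun setT phi ->
  wosc V beta c phi -> wosc V beta (rho * c) (kop Q phi).

Lemma iter_kop_wosc phi c n : 0 <= c -> measurable_fun setT phi ->
  wosc V beta c phi -> wosc V beta (rho ^+ n * c) (iter n (kop Q) phi).
Proof.
move=> c0 mp h; elim: n => [|n IH] /=; first by rewrite expr0 mul1r.
rewrite exprS -mulrA; apply: kop_wosc => //.
  by rewrite mulr_ge0// exprn_ge0// ltW.
have wp := wosc_wbounded V_ge0 (ltW beta_gt0) c0 mp h.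
by case: (wbounded_iter_kop V_ge0 mV lam_ge0 K_ge0 drift n wp).
Qed.

Lemma kiter_contraction phi c mu1 mu2 n : 0 <= c -> measurable_fun setT phi ->
  wosc V beta c phi ->
  (\int[mu1]_x (V x)%:E < +oo)%E -> (\int[mu2]_x (V x)%:E < +oo)%E ->
  \int[kiter Q mu1 n]_x phi x - \int[kiter Q mu2 n]_x phi x <=
    rho ^+ n * c * (2 + beta * \int[mu1]_x V x + beta * \int[mu2]_x V x).
Proof.
move=> c0 mp h f1 f2.
have wp := wosc_wbounded V_ge0 (ltW beta_gt0) c0 mp h.
rewrite !(Rintegral_kiter V_ge0 mV lam_ge0 K_ge0 drift)//.
apply: Rintegral_wosc => //; last exact: iter_kop_wosc.
exact: (wbounded_iter_kop V_ge0 mV lam_ge0 K_ge0 drift).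
Qed.

Let wosc_indic A : wosc V beta 1 \1_A.
Proof.
move=> x y; rewrite mul1r !indicE.
have : 0 <= beta * V x by rewrite mulr_ge0// ltW.
have : 0 <= beta * V y by rewrite mulr_ge0// ltW.
by case: (x \in A); case: (y \in A) => /=; lra.
Qed.

Lemma kiter_tv mu1 mu2 n A : measurable A ->
  (\int[mu1]_x (V x)%:E < +oo)%E -> (\int[mu2]_x (V x)%:E < +oo)%E ->
  `|fine (kiter Q mu1 n A) - fine (kiter Q mu2 n A)| <=
    rho ^+ n * (2 + beta * \int[mu1]_x V x + beta * \int[mu2]_x V x).
Proof.
move=> mA f1 f2; rewrite -!Rintegral_indic//.
have mI : measurable_fun setT (\1_A : X -> R) by exact: measurable_indic.
have h1 := kiter_contraction n ler01 mI (@wosc_indic A) f1 f2.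
have h2 := kiter_contraction n ler01 mI (@wosc_indic A) f2 f1.
rewrite mulr1 in h1 h2.
by rewrite ler_norml; apply/andP; split; lra.
Qed.

Let dirac_weight x : (\int[\d_x]_y (V y)%:E)%E = (V x)%:E.
Proof.
rewrite integral_dirac//; last exact/measurable_EFinP.
by rewrite diracT mul1e.
Qed.

Let geometric_cvg0 (a : R) : (fun n => rho ^+ n * a) @ \oo --> 0.
Proof.
rewrite (_ : (fun n => _) = geometric a rho).
  by apply: cvg_geometric; rewrite ger0_norm// ltW.
by apply/funext => n; rewrite /geometric/= mulrC.
Qed.

(** Comparing the chain started from a point with its own shifts makes the
    iterates Cauchy. Fatou's lemma gives [pi Q <= pi], which is an equality
    because both sides have mass 1. *)
Lemma exists_invariant : exists pi : probability X R,
  invariant_measure Q pi /\ (\int[pi]_x (V x)%:E < +oo)%E.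
Proof.
pose mu0 : probability X R := \d_(point : X).
(* [M] bounds [V point] and satisfies [lam * M + K <= M], so that it bounds the
   [V]-moments of all the iterates. *)
pose M := V point + K / (1 - lam).
have l1 : 0 < 1 - lam by rewrite subr_gt0.
have KM : lam * M + K <= M.
  have : (1 - lam) * (K / (1 - lam)) = K by rewrite mulrC divfK ?gt_eqF.
  have : 0 <= (1 - lam) * V point by rewrite mulr_ge0// ltW.
  by rewrite /M; lra.
have mu0M : (\int[mu0]_x (V x)%:E <= M%:E)%E.
  by rewrite dirac_weight lee_fin lerDl divr_ge0// ltW.
have munM n : (\int[kiter Q mu0 n]_x (V x)%:E <= M%:E)%E.
  exact: (kiter_weight_le V_ge0 mV lam_ge0 K_ge0 drift).
have munfin n : (\int[kiter Q mu0 n]_x (V x)%:E < +oo)%E.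
  by apply: le_lt_trans (munM n) _; rewrite ltry.
have RM n : \int[kiter Q mu0 n]_x V x <= M.
  rewrite -lee_fin (EFin_Rintegral V_ge0 mV (probability_setT _) (munfin n)).
    exact: munM.
  exact: wbounded_weight.
have [|n k A mA|pi hpi] := @uniform_cauchy_probability _ X R (kiter Q mu0)
  (fun n => rho ^+ n * (2 + 2 * beta * M)).
- exact: geometric_cvg0.
- rewrite kiterD; apply: (le_trans (kiter_tv n mA (munfin k) (munfin 0%N))).
  rewrite ler_wpM2l ?exprn_ge0 ?(ltW rho_gt0)//.
  have h1 : beta * \int[kiter Q mu0 k]_x V x <= beta * M.
    by rewrite ler_wpM2l ?(ltW beta_gt0)// RM.
  have h2 : beta * \int[kiter Q mu0 0]_x V x <= beta * M.
    by rewrite ler_wpM2l ?(ltW beta_gt0)// RM.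
  lra.
exists pi; split; last first.
  apply: (@le_lt_trans _ _ M%:E); last exact: ltry.
  apply: (setwise_fatou hpi) => [x|]; first by rewrite lee_fin.
  exact: nearW.
have le_inv A : measurable A -> (kact pi Q A <= pi A)%E.
  move=> mA; apply/lee_addgt0Pr => e e0.
  apply: (setwise_fatou hpi (f := Q ^~ A)) => //.
  have piA : pi A \is a fin_num by exact: fin_num_measure.
  have := hpi A mA; rewrite -(fineK piA) => /fine_cvg /cvgrPdist_lt /(_ _ e0).
  move=> [N _ hN]; exists N => // n /= Nn.
  have := hN n.+1 (leq_trans Nn (leqnSn n)); rewrite /= ltr_norml => /andP[h _].
  have -> : (\int[kiter Q mu0 n]_x Q x A = kiter Q mu0 n.+1 A)%E by [].
  rewrite -[leLHS]fineK; last exact: fin_num_measure.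
  by rewrite -EFinD lee_fin; move: h; rewrite /=; lra.
move=> A mA; apply/eqP; rewrite eq_le le_inv//=.
have := le_inv _ (measurableC mA); rewrite !probability_setC//.
rewrite -[X in (1 - X <= _)%E -> _]fineK; last exact: fin_num_measure.
rewrite -[X in (_ <= 1 - X)%E -> _]fineK; last exact: fin_num_measure.
rewrite -[X in _ -> (X <= _)%E]fineK; last exact: fin_num_measure.
rewrite -[X in _ -> (_ <= X)%E]fineK; last exact: fin_num_measure.
by rewrite !lee_fin lerD2l lerN2.
Qed.

(** [pi'] may fail to integrate [V], so the contraction is applied to the Dirac
    masses only: [Q^n(x, A)] tends to [pi A] for each [x], and [pi' A], which is
    the [pi']-integral of [Q^n(x, A)], follows by dominated convergence. *)
Lemma invariant_unique pi pi' A : invariant_measure Q pi ->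
  (\int[pi]_x (V x)%:E < +oo)%E -> invariant_measure Q pi' -> measurable A ->
  pi' A = pi A.
Proof.
move=> inv fpi inv' mA.
have piA : pi A \is a fin_num by exact: fin_num_measure.
have pi'A : pi' A \is a fin_num by exact: fin_num_measure.
(* Indicators are bounded: use the weight 0, which every measure integrates. *)
have w0 : wbounded (cst 0) (\1_A : X -> R).
  split; first exact: measurable_indic.
  by exists 1 => x; rewrite addr0 mulr1 indicE; case: (x \in A);
    rewrite /= ?normr1 ?normr0 ?ler01.
have drift0 x : (\int[Q x]_y ((cst 0 : X -> R) y)%:E <=
    (0 * (cst 0 : X -> R) x + 0)%:E)%E.
  by rewrite integral0_eq// mul0r addr0.
have fin0 mu : (\int[mu]_x ((cst 0 : X -> R) x)%:E < +oo)%E.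
  by rewrite integral0_eq// ltry.
have iterE mu n : fine (kiter Q mu n A) = \int[mu]_x iter n (kop Q) \1_A x.
  rewrite -Rintegral_indic//.
  exact: (@Rintegral_kiter _ _ _ Q (cst 0) 0 0).
have wn n : wbounded (cst 0) (iter n (kop Q) \1_A).
  exact: (@wbounded_iter_kop _ _ _ Q (cst 0) 0 0).
have iter01 n x : 0 <= iter n (kop Q) \1_A x <= 1.
  elim: n x => [|n IH] x /=.
    by rewrite indicE; case: (x \in A); rewrite ?lexx ?ler01.
  apply/andP; split.
    by apply: Rintegral_ge0 => y _; case/andP: (IH y).
  have h y : iter n (kop Q) \1_A y <= 1 + 0 * (cst 0 : X -> R) y.
    by rewrite mul0r addr0; case/andP: (IH y).
  have := @kop_le _ _ _ Q (cst 0) 0 0 _ _ drift0 _ 1 0 x (wn n) h.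
  by rewrite mul0r addr0; exact.
have ptw x : (fun n => (iter n (kop Q) \1_A x)%:E) @ \oo --> pi A.
  rewrite -(fineK piA); apply: cvg_EFin; first exact: nearW.
  have [dx dxE] : exists m : probability X R,
    forall f : X -> \bar R, measurable_fun setT f -> (\int[m]_y f y)%E = f x.
    exists (\d_x : probability X R) => f mf.
    by rewrite integral_dirac// diracT mul1e.
  have dfin : (\int[dx]_y (V y)%:E < +oo)%E.
    by rewrite dxE ?ltry//; exact/measurable_EFinP.
  pose a := 2 + beta * \int[dx]_y V y + beta * \int[pi]_y V y.
  have h n : `|fine (pi A) - iter n (kop Q) \1_A x| <= rho ^+ n * a.
    have := kiter_tv n mA dfin fpi.
    rewrite (invariant_kiter n inv mA) iterE distrC.
    rewrite /Rintegral dxE//.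
    by apply/measurable_EFinP; case: (wn n).
  apply/cvgrPdist_le => e e0.
  have /cvgrPdist_lt/(_ _ e0)[N _ hN] := geometric_cvg0 a.
  exists N => // n /hN /=; rewrite sub0r normrN => hn.
  by rewrite (le_trans (h n))// ltW// (le_lt_trans _ hn)// ler_norm.
have iphi n : (\int[pi']_x (iter n (kop Q) \1_A x)%:E = pi' A)%E.
  rewrite -(invariant_kiter n inv' mA) -[RHS]fineK; last exact: fin_num_measure.
  rewrite iterE (EFin_Rintegral _ _ _ (fin0 pi') (wn n))//.
  exact: probability_setT.
have [] := @dominated_convergence _ X R pi' setT measurableT
  (fun n x => (iter n (kop Q) \1_A x)%:E) (fun=> pi A) (fun=> 1%E).
- by move=> n; apply/measurable_EFinP; case: (wn n).
- exact: measurable_cst.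
- exact: aeW.
- exact: finite_measure_integrable_cst.
- apply: aeW => x n _; rewrite lee_fin ger0_norm; by case/andP: (iter01 n x).
move=> _ _; under eq_fun do rewrite iphi.
rewrite (_ : (\int[pi']_x _ = pi A)%E) => [h|]; last first.
  by rewrite integral_cst//= probability_setT mule1.
by apply: (cvg_unique (@ereal_hausdorff R) _ h); exact: cvg_cst.
Qed.

(** As [beta <= 1], a function with [V]-norm at most 1 has oscillation at most
    [1 / beta] for the weight [2 + beta V x + beta V y]. *)
Lemma dTV_contraction mu1 mu2 n :
  (\int[mu1]_x (V x)%:E < +oo)%E -> (\int[mu2]_x (V x)%:E < +oo)%E ->
  (dTV V (kiter Q mu1 n) (kiter Q mu2 n) <=
    (rho ^+ n * beta^-1 *
      (2 + beta * \int[mu1]_x V x + beta * \int[mu2]_x V x))%:E)%E.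
Proof.
move=> f1 f2; apply: ge_ereal_sup => _ [h [mh hV] <-].
have hb x : `|h x| <= 1 + V x.
  have V1 : 0 < 1 + V x by rewrite ltr_pwDl.
  have : ((`|h x| / (1 + V x))%:E <= 1)%E.
    by apply: le_trans hV; apply: ereal_sup_ubound; exists x.
  by rewrite lee_fin ler_pdivrMr// mul1r.
have wh : wbounded V h by split => //; exists 1 => x; rewrite mul1r.
have osc : wosc V beta beta^-1 h.
  move=> x y; have hx := hb x; have hy := hb y.
  apply: (@le_trans _ _ (2 + V x + V y)).
    have := ler_norm (h x); have := ler_norm (- h y); rewrite normrN; lra.
  have -> : beta^-1 * (2 + beta * V x + beta * V y) =
      beta^-1 * 2 + V x + V y by field; rewrite gt_eqF.
  by rewrite !lerD2r ler_peMl// invf_ge1.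
have g1 := kiter_weight_lty V_ge0 mV lam_ge0 K_ge0 drift n f1.
have g2 := kiter_weight_lty V_ge0 mV lam_ge0 K_ge0 drift n f2.
rewrite -(EFin_Rintegral V_ge0 mV (probability_setT _) g1 wh).
rewrite -(EFin_Rintegral V_ge0 mV (probability_setT _) g2 wh).
rewrite -EFinB lee_fin; apply: kiter_contraction => //.
by rewrite invr_ge0 ltW.
Qed.

End harris.

(** The drift brings the chain back to the sublevel sets of [V], where the
    minorization makes it forget its starting point. *)
Theorem harris d (X : measurableType d) (R : realType) (Q : R.-pker X ~> X)
    (V : X -> R) (lam K : R) :
  (forall x, 0 <= V x) -> measurable_fun setT V ->
  0 <= lam -> lam < 1 -> 0 <= K ->
  (forall x, (\int[Q x]_y (V y)%:E <= (lam * V x + K)%:E)%E) ->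
  (forall r : R, exists (al : R) (nu : probability X R),
    0 < al /\ forall x, V x <= r ->
      forall A, measurable A -> (al%:E * nu A <= Q x A)%E) ->
  exists pi : probability X R,
    [/\ invariant_measure Q pi,
        (forall pi' : probability X R, invariant_measure Q pi' ->
          forall A, measurable A -> pi' A = pi A)
      & exists C c : R,
        [/\ 0 < C, 0 < c
          & forall nu : probability X R,
              (\int[nu]_x (V x)%:E < +oo)%E ->
              forall n : nat,
              (dTV V (kiter Q nu n) pi <=
                C%:E * (1 + \int[nu]_x (V x)%:E) *
                  (expR (- (c * n%:R)))%:E)%E]].
Proof.
move=> V0 mV l0 l1 K0 drift minor.
have [beta [rho [b0 b1 r0 r1 hc]]] :=
  kop_contraction V0 mV l0 l1 K0 drift minor.
have [pi [inv fpi]] :=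
  exists_invariant V0 mV l0 l1 K0 drift b0 r0 r1 hc.
exists pi; split => //.
  move=> pi' inv' A mA.
  exact: (invariant_unique V0 mV l0 K0 drift b0 r0 r1 hc inv fpi inv' mA).
pose M := \int[pi]_x V x.
have M0 : 0 <= M by apply: Rintegral_ge0.
have ib0 : 0 < beta^-1 by rewrite invr_gt0.
exists (beta^-1 * 2 + M + 1), (- ln rho); split.
- by rewrite ltr_wpDl// addr_ge0// mulr_ge0// ltW.
- by rewrite oppr_gt0 ln_lt0// r0.
move=> nu fnu n.
rewrite mulNr opprK expRM_natr lnK ?posrE//.
have t1 : nu setT = 1%E by exact: probability_setT.
rewrite -(EFin_Rintegral V0 mV t1 fnu (wbounded_weight V0 mV)).
have dTVE : dTV V (kiter Q nu n) pi = dTV V (kiter Q nu n) (kiter Q pi n).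
  congr (ereal_sup (_ @` _)); apply/funext => h; congr (_ - _)%E.
  apply: eq_measure_integral => B mB _.
  by apply/esym; exact: invariant_kiter.
rewrite dTVE; apply: (le_trans
  (dTV_contraction V0 mV l0 K0 drift b0 b1 r0 hc n fnu fpi)).
rewrite -EFinD -!EFinM lee_fin -/M [leRHS]mulrC -mulrA.
set N := \int[nu]_x V x; have N0 : 0 <= N by apply: Rintegral_ge0.
rewrite ler_wpM2l ?exprn_ge0 ?(ltW r0)//.
have -> : beta^-1 * (2 + beta * N + beta * M) = beta^-1 * 2 + N + M.
  by field; rewrite gt_eqF.
have : 0 <= (beta^-1 * 2 + M) * N.
  by rewrite mulr_ge0// addr_ge0// mulr_ge0// ltW.
lra.
Qed.

(** * The standard Gaussian vector *)

Section density.
Context d (X : measurableType d) (R : realType).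
Variables (mu nu : {measure set X -> \bar R}) (g : X -> R).
Hypotheses (g_ge0 : forall x, 0 <= g x) (mg : measurable_fun setT g).
Hypothesis nuE :
  forall A, measurable A -> nu A = (\int[mu]_(x in A) (g x)%:E)%E.
Local Open Scope ereal_scope.
Import HBNNSimple.

Let mgE : measurable_fun setT (EFin \o g).
Proof. exact/measurable_EFinP. Qed.

Let integral_density_nnsfun (h : {nnsfun X >-> R}) :
  \int[nu]_x (h x)%:E = \int[mu]_x ((h x)%:E * (g x)%:E).
Proof.
rewrite integralT_nnsfun sintegralE.
transitivity (\int[mu]_x
    \sum_(r \in range h) (r%:E * (\1_(h @^-1` [set r]) x)%:E * (g x)%:E)).
  rewrite ge0_integral_fsum//; last 2 first.
  - move=> r; apply: emeasurable_funM => //; apply: measurable_funeM.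
    by apply/measurable_EFinP; exact: measurable_indic.
  - move=> r x _; rewrite mule_ge0 ?lee_fin//.
    exact: nnfun_muleindic_ge0.
  apply: eq_fsbigr => r _.
  have [r0|r0] := leP 0%R r; last first.
    rewrite preimage_nnfun0// measure0 mule0; apply/esym/integral0_eq => x _.
    by rewrite indic0 mule0 mul0e.
  under eq_integral do rewrite -muleA.
  rewrite ge0_integralZl//; last 2 first.
  - apply: emeasurable_funM => //.
    by apply/measurable_EFinP; exact: measurable_indic.
  - by move=> x _; rewrite mule_ge0 ?lee_fin// indicE; case: (x \in _).
  rewrite nuE// integral_mkcond; congr (_ * _); apply: eq_integral => x _.
  by rewrite patchE indicE; case: (x \in _); rewrite ?mul1e ?mul0e.
apply: eq_integral => x _; rewrite -ge0_mule_fsuml//.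
  by rewrite fsumEFin// -fimfunE.
move=> r; exact: nnfun_muleindic_ge0.
Qed.

Lemma integral_density (f : X -> \bar R) : (forall x, 0 <= f x) ->
  measurable_fun setT f -> \int[nu]_x f x = \int[mu]_x (f x * (g x)%:E).
Proof.
move=> f0 mf; pose f_ := nnsfun_approx measurableT mf.
have cvgf x : (fun n => (f_ n x)%:E) @ \oo --> f x by exact: cvg_nnsfun_approx.
have nd x : {homo (fun n => (f_ n x)%:E) : a b / (a <= b)%N >-> a <= b}.
  by move=> a b ab; rewrite lee_fin; exact/lefP/nd_nnsfun_approx.
transitivity (limn (fun n => \int[nu]_x (f_ n x)%:E)).
  rewrite -monotone_convergence//=.
  - by apply: eq_integral => y _; apply/esym/cvg_lim.
  - by move=> n; exact/measurable_EFinP/measurable_funTS.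
  - by move=> n y _; rewrite lee_fin.
rewrite (_ : (fun n => _) = fun n => \int[mu]_x ((f_ n x)%:E * (g x)%:E));
  last by apply/funext => n; exact: integral_density_nnsfun.
rewrite -monotone_convergence//=.
- apply: eq_integral => x _; apply/cvg_lim => //.
  by apply: cvgeZr.
- move=> n; apply: emeasurable_funM => //.
  exact/measurable_EFinP/measurable_funTS.
- by move=> n y _; rewrite mule_ge0// lee_fin.
- by move=> y _ a b ab; rewrite lee_wpmul2r ?lee_fin//; exact: nd.
Qed.

End density.

Section gaussian_line.
Variable R : realType.
Local Notation lebesgue := (@lebesgue_measure R).
Local Notation N01 := (normal_prob (0 : R) 1).

Let pdfE (s x : R) : s != 0 ->
  normal_pdf 0 s x = normal_peak s * expR (- (x ^+ 2 / (s ^+ 2 *+ 2))).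
Proof. by move=> s0; rewrite normal_pdfE// /normal_fun subr0 mulNr. Qed.

(** [z^2 exp (- z^2 / 2) <= 4 exp (- z^2 / 4)], and the right-hand side is a
    multiple of the density of variance 2. *)
Lemma normal_second_moment : (\int[N01]_z (z ^+ 2)%:E < +oo)%E.
Proof.
rewrite (@integral_density _ _ _ lebesgue _ (normal_pdf 0 1))//; last 4 first.
- by move=> x; exact: normal_pdf_ge0.
- exact: measurable_normal_pdf.
- by move=> x; rewrite lee_fin sqr_ge0.
- by apply/measurable_EFinP; exact: exprn_measurable.
pose s : R := Num.sqrt 2.
have s2 : s ^+ 2 = 2 by rewrite sqr_sqrtr.
have s0 : s != 0 by rewrite gt_eqF// sqrtr_gt0.
have p0 := normal_peak_gt0 s0.
pose C : R := 4 * normal_peak 1 / normal_peak s.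
have C0 : 0 <= C by rewrite !mulr_ge0 ?invr_ge0 ?normal_peak_ge0.
apply: (@le_lt_trans _ _ (\int[lebesgue]_x (C%:E * (normal_pdf 0 s x)%:E))%E).
  apply: ge0_le_integral => //.
  - by move=> x _; rewrite -EFinM lee_fin mulr_ge0 ?sqr_ge0 ?normal_pdf_ge0.
  - apply/measurable_EFinP; apply: measurable_funM.
      exact: exprn_measurable.
    exact: measurable_normal_pdf.
  - apply: measurable_funeM; apply/measurable_EFinP.
    exact: measurable_normal_pdf.
  move=> x _; rewrite -!EFinM lee_fin !pdfE ?oner_neq0// s2 expr1n.
  set t := x ^+ 2 / (2 *+ 2).
  have x2 : x ^+ 2 = 4 * t by rewrite /t mulr2n; field.
  have -> : - (x ^+ 2 / (1 *+ 2)) = - t + - t by rewrite x2 mulr2n; field.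
  have -> : C * (normal_peak s * expR (- t)) =
      normal_peak 1 * expR (- t) * 4 by rewrite /C; field; rewrite gt_eqF.
  have -> : x ^+ 2 * (normal_peak 1 * expR (- t + - t)) =
      normal_peak 1 * expR (- t) * (4 * (t * expR (- t))).
    by rewrite expRD x2; ring.
  rewrite ler_wpM2l ?mulr_ge0 ?normal_peak_ge0 ?expR_ge0// ler_piMr//.
  rewrite expRN ler_pdivrMr ?expR_gt0// mul1r.
  by apply: le_trans (expR_ge1Dx t); rewrite lerDr.
rewrite ge0_integralZl//.
- by rewrite integral_normal_pdf mule1 ltry.
- by apply/measurable_EFinP; exact: measurable_normal_pdf.
- by move=> x _; rewrite lee_fin normal_pdf_ge0.
Qed.

Lemma lebesgue_affine (a s : R) (A : set (measurableTypeR R)) : 0 < s ->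
  measurable A ->
  lebesgue A = (s%:E * lebesgue ((fun z : R => (a + s * z)%R) @^-1` A))%E.
Proof.
move=> s0 mA.
pose T : measurableTypeR R -> measurableTypeR R := fun z => a + s * z.
have mT : measurable_fun setT T.
  by apply: measurable_funD => //; exact: measurable_funM.
pose Tm : {mfun measurableTypeR R >-> measurableTypeR R} :=
  HB.pack T (isMeasurableFun.Build _ _ _ _ T mT).
have := @lebesgue_measure_unique R
  (mscale (NngNum (ltW s0)) (pushforward lebesgue Tm)).
move=> ->//= _ [[x y] _ <-].
rewrite /mscale/= /pushforward/=.
have -> : T @^-1` `]x, y] = `](x - a) / s, (y - a) / s]%classic.
  apply/seteqP; split => z /=; rewrite !in_itv/= ltr_pdivrMr// ler_pdivlMr//
    ltrBlDl lerBrDl (mulrC z) //.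
rewrite !lebesgue_measure_itv/= !lte_fin ltr_pM2r ?invr_gt0// ltrD2r.
case: ifPn => _; last by rewrite mule0.
by rewrite -!EFinD -EFinM; congr EFin; field; rewrite gt_eqF.
Qed.

Lemma uniform01E (A : set (measurableTypeR R)) : measurable A ->
  uniform_prob (@ltr01 R) A = lebesgue (A `&` `[0, 1]).
Proof.
move=> mA; rewrite /uniform_prob integral_uniform_pdf.
rewrite -[RHS]mul1e -integral_cst//; last exact: measurableI.
apply: eq_integral => x /[!inE] -[_ /=]; rewrite in_itv/= => x01.
by rewrite /uniform_pdf x01 subr0 invr1.
Qed.

(** Gaussians with means in a bounded set dominate a multiple of the same
    uniform law: their densities are bounded below on [0, 1]. *)
Lemma normal_affine_minorization (M s : R) : 0 <= M -> 0 < s ->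
  exists2 e : R, 0 < e & forall a : R, `|a| <= M ->
    forall A : set (measurableTypeR R), measurable A ->
    (e%:E * uniform_prob (@ltr01 R) A <=
      N01 ((fun z : R => (a + s * z)%R) @^-1` A))%E.
Proof.
move=> M0 s0.
(* [a + s z] in [0, 1] forces [|z| <= B], where the density is at least [c]. *)
pose B := (M + 1) / s.
pose c := normal_peak 1 * expR (- (B ^+ 2 / 2)) : R.
have c0 : 0 < c by rewrite mulr_gt0 ?expR_gt0 ?normal_peak_gt0 ?oner_neq0.
exists (c / s); first exact: divr_gt0.
move=> a aM A mA; set T := fun z : R => a + s * z.
have mT : measurable_fun setT (T : measurableTypeR R -> measurableTypeR R).
  by apply: measurable_funD => //; exact: measurable_funM.
have mA01 : measurable (A `&` `[0, 1]) by exact: measurableI.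
have mpre (C : set (measurableTypeR R)) :
    measurable C -> measurable (T @^-1` C).
  by move=> mC; rewrite -[X in measurable X]setTI; exact: mT.
rewrite uniform01E// (@lebesgue_affine a s)// -/T muleA -EFinM.
rewrite divfK ?gt_eqF//.
apply: (@le_trans _ _ (N01 (T @^-1` (A `&` `[0, 1])))); last first.
  by apply: le_measure; rewrite ?inE//; [exact: mpre|exact: mpre|move=> z []].
rewrite /normal_prob -integral_cst//; last exact: mpre.
apply: ge0_le_integral => //.
- exact: mpre.
- by move=> x _; rewrite lee_fin ltW.
- by apply/measurable_EFinP/measurable_funTS; exact: measurable_normal_pdf.
move=> x [_ /=]; rewrite in_itv/= => /andP[Tx0 Tx1].
rewrite lee_fin pdfE ?oner_neq0// ler_wpM2l ?normal_peak_ge0// ler_expR lerN2.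
rewrite expr1n mulr2n ler_pM2r ?invr_gt0//.
rewrite -[leLHS]real_normK ?num_real// lerXn2r ?nnegrE//.
  by rewrite divr_ge0 ?(ltW s0)// addr_ge0.
rewrite ler_pdivlMr// -[X in _ * X](gtr0_norm s0) -normrM mulrC.
move: Tx0 Tx1 aM; rewrite /T !ler_norml => ? ? /andP[? ?].
by apply/andP; split; lra.
Qed.

End gaussian_line.

Section gaussian_vector.
Variable R : realType.
Local Notation N01 := (normal_prob (0 : R) 1).
Local Notation unif := (uniform_prob (@ltr01 R)).

(** The uniform law on the unit cube, built coordinate by coordinate in the
    same way as the Gaussian law so that the two can be compared by
    induction. *)
Fixpoint cube_prob d : probability 'rV[R]_d R :=
  match d with
  | 0 => \d_(0 : 'rV[R]_0)
  | d'.+1 => distribution (unif \x cube_prob d')%E (@cons_rV R d')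
  end.

Lemma measurable_affine_rV d (a : 'rV[R]_d) (s : R) :
  measurable_fun setT (fun g : 'rV[R]_d => a + s *: g).
Proof.
apply/measurable_fun_rVP => i; under eq_fun do rewrite !mxE.
apply: measurable_funD => //; apply: measurable_funM => //.
exact: measurable_coord.
Qed.

Lemma measurable_sqenorm d : measurable_fun setT (@sqenorm R d).
Proof.
apply: measurable_sum => i; apply: measurable_funX.
exact: measurable_coord.
Qed.

Let measurable_cons d : measurable_fun setT (@cons_rV R d).
Proof. exact: measurable_funPT. Qed.

(** Slice along the first coordinate: the induction hypothesis bounds each slice
    and the one-dimensional case the integral of the slices. *)
Lemma std_gauss_affine_minorization d (M s : R) : 0 <= M -> 0 < s ->
  exists2 e : R, 0 < e & forall a : 'rV[R]_d, (forall i, `|a 0 i| <= M) ->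
    forall A, measurable A ->
    (e%:E * cube_prob d A <=
      std_gauss R d ((fun g => (a + s *: g)%R) @^-1` A))%E.
Proof.
move=> M0 s0; have [e1 e10 h1] := normal_affine_minorization M0 s0.
elim: d => [|d [e e0 IH]].
  exists 1 => // a _ A mA; rewrite mul1e (_ : _ @^-1` A = A)//.
  by apply/seteqP; split => g /=; rewrite (thinmx0 (a + _)) (thinmx0 g).
exists (e1 * e) => [|a aM A mA]; first exact: mulr_gt0.
pose a' : 'rV[R]_d := \row_i a 0 (lift ord0 i).
pose T (z : measurableTypeR R) : measurableTypeR R := a 0 ord0 + s * z.
have mT : measurable_fun setT T.
  by apply: measurable_funD => //; exact: measurable_funM.
pose Tm : {mfun measurableTypeR R >-> measurableTypeR R} :=
  HB.pack T (isMeasurableFun.Build _ _ _ _ T mT).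
pose C := @cons_rV R d @^-1` A.
have mC : measurable C.
  by rewrite /C -[X in measurable X]setTI; exact: measurable_cons.
pose F z : \bar R := cube_prob d (xsection C z).
have F0 z : (0 <= F z)%E by exact: measure_ge0.
have mF : measurable_fun setT F by exact: measurable_fun_xsection.
have -> : cube_prob d.+1 A = (\int[unif]_z F z)%E by [].
pose S := @cons_rV R d @^-1` ((fun g => (a + s *: g)%R) @^-1` A).
have -> : std_gauss R d.+1 ((fun g => (a + s *: g)%R) @^-1` A) =
  (\int[N01]_z std_gauss R d (xsection S z))%E by [].
have SE z : xsection S z = (fun g => a' + s *: g) @^-1` (xsection C (T z)).
  apply/seteqP; split => g; rewrite /xsection/= !inE /S /C /=.
    rewrite (_ : a + _ = cons_rV (T z, a' + s *: g))//.
    apply/rowP => i; rewrite !mxE; case: (unliftP ord0 i) => [j ->|->] //=.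
    by rewrite !mxE.
  rewrite (_ : cons_rV (T z, a' + s *: g) = a + s *: cons_rV (z, g))//.
  apply/rowP => i; rewrite !mxE; case: (unliftP ord0 i) => [j ->|->] //=.
  by rewrite !mxE.
have mS : measurable S.
  rewrite /S -[X in measurable X]setTI; apply: measurable_cons => //.
  by rewrite -[X in measurable X]setTI; exact: measurable_affine_rV.
apply: (@le_trans _ _ (\int[N01]_z (e%:E * F (T z)))%E); last first.
  apply: ge0_le_integral => //.
  - by move=> z _; rewrite mule_ge0// lee_fin ltW.
  - by apply: measurable_funeM; exact: (measurableT_comp mF mT).
  - exact: measurable_fun_xsection.
  move=> z _; rewrite SE; apply: IH; last exact: measurable_xsection.
  by move=> i; rewrite mxE.
rewrite ge0_integralZl//; last 2 first.
- exact: (measurableT_comp mF mT).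
- by rewrite lee_fin ltW.
have -> : (\int[N01]_z F (T z) = \int[pushforward N01 Tm]_z F z)%E.
  by rewrite ge0_integral_pushforward// => x _; exact: F0.
rewrite mulrC EFinM -muleA lee_wpmul2l ?lee_fin ?(ltW e0)//.
apply: ge0_le_scale_integral => //; first exact: ltW.
by move=> B mB; apply: h1.
Qed.

Lemma std_gauss_second_moment d :
  (\int[std_gauss R d]_g (sqenorm g)%:E < +oo)%E.
Proof.
have ms k : measurable_fun setT (fun g : 'rV[R]_k => (sqenorm g)%:E).
  by apply/measurable_EFinP; exact: measurable_sqenorm.
elim: d => [|d IH].
  rewrite /= integral_dirac//; first by rewrite diracT mul1e ltry.
  exact: ms.
rewrite /= /distribution ge0_integral_pushforward//; last 2 first.
- exact: ms.
- by move=> g _; rewrite lee_fin sqenorm_ge0.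
rewrite preimage_setT.
have -> : (fun g : 'rV[R]_d.+1 => (sqenorm g)%:E) \o @cons_rV R d =
    fun z => ((z.1 ^+ 2)%:E + (sqenorm z.2)%:E)%E.
  apply/funext => -[z g]; rewrite /= /sqenorm big_ord_recl cons_rV0 -EFinD.
  by congr (_ + _)%:E; apply: eq_bigr => i _; rewrite cons_rVS.
have m1 : measurable_fun setT
    (fun z : measurableTypeR R * 'rV[R]_d => (z.1 ^+ 2)%:E).
  apply/measurable_EFinP; apply: measurable_funX; exact: measurable_fst.
have m2 : measurable_fun setT
    (fun z : measurableTypeR R * 'rV[R]_d => (sqenorm z.2)%:E).
  exact: (measurableT_comp (ms d) measurable_snd).
rewrite ge0_integralD//; last 2 first.
- by move=> z _; rewrite lee_fin sqr_ge0.
- by move=> z _; rewrite lee_fin sqenorm_ge0.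
rewrite !fubini_tonelli1//; last 2 first.
- by move=> z; rewrite lee_fin sqenorm_ge0.
- by move=> z; rewrite lee_fin sqr_ge0.
rewrite /fubini_F/=.
under eq_integral do rewrite integral_cst//= probability_setT mule1.
rewrite [X in (_ + X)%E]integral_cst//= probability_setT mule1.
by rewrite lte_add_pinfty// normal_second_moment.
Qed.

Lemma std_gauss_cube_gt0 d :
  (0 < std_gauss R d
    ([set g : 'rV[R]_d | forall i, `[-1, 1]%classic (g 0 i)])%R)%E.
Proof.
rewrite (@std_gauss_box R d (fun=> `[-1, 1]%classic))//.
have [e e0 he] := normal_affine_minorization (lexx 0) (@ltr01 R).
have N0 : (0 < N01 (`[-1, 1]%classic)%R)%E.
  have n0 : `|0 : R| <= 0 by rewrite normr0.
  have h := he 0 n0 `[-1, 1]%classic (measurable_itv _).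
  have pre : (fun z : R => 0 + 1 * z) @^-1` `[-1, 1]%classic = `[-1, 1]%classic.
    by apply/seteqP; split => z /=; rewrite add0r mul1r.
  rewrite pre in h; apply: lt_le_trans h.
  rewrite mule_gt0 ?lte_fin// /uniform_prob integral_uniform_pdf1 ?lte_fin//.
  by move=> z /=; rewrite !in_itv/= => /andP[z0 ->]; rewrite (le_trans _ z0).
by elim/big_ind : _ => //; exact: mule_gt0.
Qed.

End gaussian_vector.

(** * Marginals of a product law *)

Section product_marginals.
Context d1 d2 (X : measurableType d1) (Y : measurableType d2) (R : realType).
Variables (P : probability X R) (P' : probability Y R).
Local Open Scope ereal_scope.

Lemma integral_product_fst (f : X -> \bar R) : (forall x, 0 <= f x) ->
  measurable_fun setT f -> \int[P \x P']_z f z.1 = \int[P]_x f x.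
Proof.
move=> f0 mf; rewrite (fubini_tonelli1 (fun z : X * Y => f z.1))//.
  apply: eq_integral => x _.
  rewrite (_ : fubini_F _ _ x = \int[P']_y cst (f x) y)//.
  by rewrite integral_cst//= probability_setT mule1.
exact: measurableT_comp mf measurable_fst.
Qed.

Lemma integral_product_snd (f : Y -> \bar R) : (forall y, 0 <= f y) ->
  measurable_fun setT f -> \int[P \x P']_z f z.2 = \int[P']_y f y.
Proof.
move=> f0 mf; rewrite (fubini_tonelli2 (fun z : X * Y => f z.2))//.
  apply: eq_integral => y _.
  rewrite (_ : fubini_G _ _ y = \int[P]_x cst (f y) x)//.
  by rewrite integral_cst//= probability_setT mule1.
exact: measurableT_comp mf measurable_snd.
Qed.

Lemma product_ge_xsection (B : set (X * Y)) (D : set X) (c : \bar R) :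
  measurable B -> measurable D -> 0 <= c ->
  (forall x, D x -> c <= P' (xsection B x)) -> c * P D <= (P \x P') B.
Proof.
move=> mB mD c0 h.
have -> : (P \x P') B = \int[P]_x P' (xsection B x) by [].
have mF : measurable_fun setT (fun x => P' (xsection B x)).
  exact: measurable_fun_xsection.
rewrite -integral_cst//.
apply: (@le_trans _ _ (\int[P]_(x in D) P' (xsection B x))).
  by apply: ge0_le_integral => //; exact: measurable_funTS.
exact: ge0_subset_integral.
Qed.

Lemma product_ge_ysection (B : set (X * Y)) (D : set Y) (c : \bar R) :
  measurable B -> measurable D -> 0 <= c ->
  (forall y, D y -> c <= P (ysection B y)) -> c * P' D <= (P \x P') B.
Proof.
move=> mB mD c0 h.
have -> : (P \x P') B = (P \x^ P') B.
  by apply: product_measure_unique => //= ? ? ? ?; rewrite product_measure2E.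
have -> : (P \x^ P') B = \int[P']_y P (ysection B y) by [].
have mF : measurable_fun setT (fun y => P (ysection B y)).
  exact: measurable_fun_ysection.
rewrite -integral_cst//.
apply: (@le_trans _ _ (\int[P']_(y in D) P (ysection B y))).
  by apply: ge0_le_integral => //; exact: measurable_funTS.
exact: ge0_subset_integral.
Qed.

End product_marginals.

(** * The transition kernel of the chain *)

Section rlmc_kernel_bounds.
Variables (R : realType) (d : nat) (U : 'rV[R]_d -> R) (m L : R).
Hypotheses (hU : C2 U) (gradU0 : grad U 0 = 0) (m_gt0 : 0 < m) (m_lt_L : m < L)
  (hessU : forall x : 'rV[R]_d,
      loewner_le m%:M (hess U x) /\ loewner_le (hess U x) L%:M).
Variable eta : R.
Hypotheses (eta_gt0 : 0 < eta) (eta_le : eta <= m / L ^+ 2).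

Local Notation noise := (rlmc_noise R d).
Local Notation noiseT := (measurableTypeR R * ('rV[R]_d * 'rV[R]_d))%type.
Local Notation Q := (rlmc_kernel eta hU).
Local Notation gauss := (std_gauss R d).

Let measurable_update x : measurable_fun setT (rlmc_update eta hU x).
Proof. exact: measurable_funPT. Qed.

Lemma integral_rlmc_kernel (f : 'rV[R]_d -> \bar R) x :
  (forall y, (0 <= f y)%E) -> measurable_fun setT f ->
  (\int[Q x]_y f y = \int[noise]_z f (rlmc_update eta hU x z))%E.
Proof. by move=> f0 mf; rewrite [LHS]ge0_integral_pushforward// => y _. Qed.

Let snd_moment : R := \int[gauss]_g sqenorm g.

Let snd_momentE : (\int[gauss]_g (sqenorm g)%:E = snd_moment%:E)%E.
Proof.
rewrite fineK// ge0_fin_numE ?std_gauss_second_moment//.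
by apply: integral_ge0 => g _; rewrite lee_fin sqenorm_ge0.
Qed.

Let mg1 : measurable_fun setT (fun z : noiseT => (sqenorm z.2.1)%:E).
Proof.
apply/measurable_EFinP; apply: (measurableT_comp (@measurable_sqenorm R d)).
exact: measurableT_comp measurable_fst measurable_snd.
Qed.

Let mg2 : measurable_fun setT (fun z : noiseT => (sqenorm z.2.2)%:E).
Proof.
apply/measurable_EFinP; apply: (measurableT_comp (@measurable_sqenorm R d)).
exact: measurableT_comp measurable_snd measurable_snd.
Qed.

Let noise_moment1 : (\int[noise]_z (sqenorm z.2.1)%:E = snd_moment%:E)%E.
Proof.
rewrite (integral_product_snd _ _
  (f := fun y : 'rV[R]_d * 'rV[R]_d => (sqenorm y.1)%:E)).
- rewrite (integral_product_fst _ _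
    (f := fun g : 'rV[R]_d => (sqenorm g)%:E))//.
  + by move=> g; rewrite lee_fin sqenorm_ge0.
  + by apply/measurable_EFinP; exact: measurable_sqenorm.
- by move=> y; rewrite lee_fin sqenorm_ge0.
- apply/measurable_EFinP.
  exact: (measurableT_comp (@measurable_sqenorm R d) measurable_fst).
Qed.

Let noise_moment2 : (\int[noise]_z (sqenorm z.2.2)%:E = snd_moment%:E)%E.
Proof.
rewrite (integral_product_snd _ _
  (f := fun y : 'rV[R]_d * 'rV[R]_d => (sqenorm y.2)%:E)).
- rewrite (integral_product_snd _ _
    (f := fun g : 'rV[R]_d => (sqenorm g)%:E))//.
  + by move=> g; rewrite lee_fin sqenorm_ge0.
  + by apply/measurable_EFinP; exact: measurable_sqenorm.
- by move=> y; rewrite lee_fin sqenorm_ge0.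
- apply/measurable_EFinP.
  exact: (measurableT_comp (@measurable_sqenorm R d) measurable_snd).
Qed.

Let unif01 : uniform_prob (@ltr01 R) `[0, 1]%classic = 1%E.
Proof. exact: integral_uniform_pdf1. Qed.

Let noise_ae01 : {ae noise, forall z : noiseT, 0 <= z.1 <= 1}.
Proof.
pose A : set (measurableTypeR R) := ~` `[0, 1]%classic.
have mA : measurable A by apply: measurableC; exact: measurable_itv.
have A0 : uniform_prob (@ltr01 R) A = 0%E.
  rewrite probability_setC; last exact: measurable_itv.
  rewrite [X in (1 - X)%E](_ : _ = 1%E); last exact: unif01.
  by rewrite subee.
exists (A `*` setT); split.
- exact: measurableX.
- rewrite [LHS](_ : _ = uniform_prob (@ltr01 R) A * (gauss \x gauss) setT)%E.
    by rewrite A0 mul0e.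
  exact: product_measure1E.
- by move=> z /= hz; split => //=; rewrite /A /= in_itv.
Qed.

(** The pointwise drift holds when the uniform variable is in [0, 1], hence
    almost surely; integrate it. *)
Lemma rlmc_kernel_drift : exists lam K : R, [/\ 0 <= lam, lam < 1, 0 <= K &
  forall x, (\int[Q x]_y (1 + sqenorm y)%:E <=
    (lam * (1 + sqenorm x) + K)%:E)%E].
Proof.
have [lam [K [l0 l1 K0 h]]] :=
  rlmc_step_drift hU gradU0 m_gt0 m_lt_L hessU eta_gt0 eta_le.
have s0 : 0 <= snd_moment.
  by apply: Rintegral_ge0 => g _; exact: sqenorm_ge0.
exists lam, (1 - lam + 2 * K * snd_moment); split => //.
  by rewrite addr_ge0// ?subr_ge0 ?(ltW l1)// !mulr_ge0.
move=> x.
have mV : measurable_fun setT (fun y : 'rV[R]_d => (1 + sqenorm y)%:E).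
  apply/measurable_EFinP; apply: measurable_funD => //.
  exact: measurable_sqenorm.
have V0 (y : 'rV[R]_d) : (0 <= (1 + sqenorm y)%:E)%E.
  by rewrite lee_fin addr_ge0// sqenorm_ge0.
rewrite integral_rlmc_kernel//.
have mGE : measurable_fun setT (fun z : noiseT => (1 + lam * sqenorm x)%:E +
    K%:E * ((sqenorm z.2.1)%:E + (sqenorm z.2.2)%:E))%E.
  apply: emeasurable_funD => //; apply: measurable_funeM.
  exact: emeasurable_funD.
have GE (z : noiseT) : ((1 + lam * sqenorm x)%:E +
    K%:E * ((sqenorm z.2.1)%:E + (sqenorm z.2.2)%:E) =
    ((1 + lam * sqenorm x) + K * (sqenorm z.2.1 + sqenorm z.2.2))%:E)%E by [].
apply: (@le_trans _ _ (\int[noise]_z ((1 + lam * sqenorm x)%:E +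
   K%:E * ((sqenorm z.2.1)%:E + (sqenorm z.2.2)%:E)))%E).
  apply: ae_ge0_le_integral => //.
  - exact: (measurableT_comp mV (measurable_update x)).
  - move=> z _; rewrite GE lee_fin.
    by rewrite !addr_ge0 ?mulr_ge0 ?addr_ge0 ?sqenorm_ge0.
  - move: noise_ae01; apply: filterS => z z01 _.
    by rewrite GE lee_fin -addrA lerD2l; exact: h.
rewrite ge0_integralD//; last 3 first.
- by move=> z _; rewrite lee_fin addr_ge0// mulr_ge0// sqenorm_ge0.
- by move=> z _; rewrite mule_ge0 ?adde_ge0 ?lee_fin ?sqenorm_ge0.
- by apply: measurable_funeM; exact: emeasurable_funD.
rewrite ge0_integralZl//; last 2 first.
- exact: emeasurable_funD.
- by move=> z _; rewrite adde_ge0 ?lee_fin ?sqenorm_ge0.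
rewrite ge0_integralD//; last 2 first.
- by move=> z _; rewrite lee_fin sqenorm_ge0.
- by move=> z _; rewrite lee_fin sqenorm_ge0.
rewrite noise_moment1 noise_moment2 integral_cst//= probability_setT mule1.
rewrite [leLHS](_ : _ =
  (1 + lam * sqenorm x + K * (snd_moment + snd_moment))%:E)//.
by rewrite lee_fin; lra.
Qed.

(** Given a value in [0, 1] of the uniform variable and a value in [-1, 1]^d of
    the inner Gaussian, the next state is Gaussian with a mean that stays in a
    bounded set. *)
Lemma rlmc_kernel_minorization (r : R) :
  exists (al : R) (nu : probability 'rV[R]_d R), 0 < al /\
    forall x, 1 + sqenorm x <= r ->
      forall A, measurable A -> (al%:E * nu A <= Q x A)%E.
Proof.
have [lam [K [l0 l1 K0 h]]] :=
  rlmc_step_drift hU gradU0 m_gt0 m_lt_L hessU eta_gt0 eta_le.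
(* The pointwise drift with zero outer noise bounds the squared norm of the
   mean by [M - 1], and [|t| <= 1 + t^2]. *)
pose M := 1 + (lam * `|r| + K * d%:R).
have M0 : 0 <= M by rewrite !addr_ge0// mulr_ge0.
have s0 : 0 < Num.sqrt (2 * eta) by rewrite sqrtr_gt0 mulr_gt0.
have [e e0 he] := std_gauss_affine_minorization d M0 s0.
pose cube := [set g : 'rV[R]_d | forall i, `[-1, 1]%classic (g 0 i)].
have mcube : measurable cube.
  by apply: (@measurable_box R d (fun=> `[-1, 1]%classic)).
pose p := fine (gauss cube).
have pE : gauss cube = p%:E by rewrite fineK//; exact: fin_num_measure.
have p0 : 0 < p by rewrite -lte_fin -pE std_gauss_cube_gt0.
exists (p * e), (cube_prob R d); split; first exact: mulr_gt0.
move=> x xr A mA.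
pose B := rlmc_update eta hU x @^-1` A.
have mB : measurable B.
  by rewrite /B -[X in measurable X]setTI; exact: measurable_update.
have c0 : (0 <= e%:E * cube_prob R d A)%E by rewrite mule_ge0// lee_fin ltW.
have -> : Q x A = noise B by [].
have mI : measurable (`[0, 1]%classic : set (measurableTypeR R)).
  exact: measurable_itv.
have -> : ((p * e)%:E * cube_prob R d A =
    e%:E * cube_prob R d A * gauss cube *
      uniform_prob (@ltr01 R) (`[0, 1]%classic)%R)%E.
  by rewrite pE unif01 mule1 [RHS]muleC muleA EFinM.
apply: product_ge_xsection => //; first exact: mule_ge0.
move=> u /=; rewrite in_itv/= => u01.
apply: product_ge_ysection => //; first exact: measurable_xsection.
move=> g' g'cube.
pose a := x - eta *: grad U (rlmc_mid U eta x u g').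
  have aM i : `|a 0 i| <= M.
    have aE : a = rlmc_step U eta x u 0 g' by rewrite /rlmc_step scaler0 addr0.
    have := h x u 0 g' u01; rewrite -aE.
    have -> : sqenorm (0 : 'rV[R]_d) = 0.
      by rewrite /sqenorm big1// => j _; rewrite mxE expr0n.
    have g'd : sqenorm g' <= d%:R.
      rewrite -[d in d%:R]card_ord -sum1_card natr_sum; apply: ler_sum => j _.
      have := g'cube j; rewrite /= in_itv/= -ler_norml => hj.
      by rewrite -real_normK ?num_real// expr_le1.
    rewrite add0r => ha.
    have ai : `|a 0 i| ^+ 2 <= sqenorm a.
      rewrite real_normK ?num_real// /sqenorm (bigD1 i)//= lerDl.
      by apply: sumr_ge0 => j _; exact: sqr_ge0.
    have hr : lam * sqenorm x <= lam * `|r|.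
      rewrite ler_wpM2l// (le_trans _ (ler_norm r))// (le_trans _ xr)//.
      by rewrite lerDr.
    have hK : K * sqenorm g' <= K * d%:R by rewrite ler_wpM2l.
    have hsq : `|a 0 i| <= 1 + `|a 0 i| ^+ 2.
      by have := sqr_ge0 (`|a 0 i| - 1); have := normr_ge0 (a 0 i); nra.
    rewrite /M; lra.
rewrite (_ : ysection _ _ = (fun g => a + Num.sqrt (2 * eta) *: g) @^-1` A).
  exact: he.
apply/seteqP; split => g; rewrite /ysection /xsection /=.
  by move=> /set_mem /set_mem.
by move=> gA; apply/mem_set/mem_set.
Qed.

End rlmc_kernel_bounds.

(** * The law of the chain driven by independent noise *)

Lemma product_xsectionE d1 d2 (X : measurableType d1) (Y : measurableType d2)
    (R : realType) (P : probability X R) (P' : probability Y R)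
    (B : set (X * Y)) :
  ((P \x P') B = \int[P]_x P' (xsection B x))%E.
Proof. by []. Qed.

Section independent_pair.
Context dO dS dT (Omega : measurableType dO) (S : measurableType dS)
  (T : measurableType dT) (R : realType).
Variables (P : probability Omega R) (X : Omega -> S) (Y : Omega -> T).
Hypotheses (mX : measurable_fun setT X) (mY : measurable_fun setT Y).
Variables (muX : probability S R) (muY : probability T R) (E : set Omega).
Hypothesis mE : measurable E.
Local Open Scope ereal_scope.

(** Independence of [X], [Y] and [E] on rectangles extends to all measurable
    sets of the product: normalize by [P E] and use that a measure on the
    product is determined by its rectangles. *)
Lemma independent_pair :
  (forall A B, measurable A -> measurable B ->
    P (X @^-1` A `&` (Y @^-1` B `&` E)) = muX A * (muY B * P E)) ->
  forall C, measurable C ->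
    P ((fun w => (X w, Y w)) @^-1` C `&` E) = (muX \x muY) C * P E.
Proof.
move=> h C mC.
pose XY := fun w => (X w, Y w).
have mXY : measurable_fun setT XY by exact: measurable_fun_pair.
have mXYC D : measurable D -> measurable (XY @^-1` D).
  by move=> mD; rewrite -[X in measurable X]setTI; exact: mXY.
have PEfin : P E \is a fin_num by exact: fin_num_measure.
have [PE0|PE0] := eqVneq (P E) 0.
  rewrite PE0 mule0; apply/eqP; rewrite eq_le measure_ge0 andbT -PE0.
  apply: le_measure => [||w []//]; apply/mem_set => //.
  by apply: measurableI => //; exact: mXYC.
have p0 : (0 < fine (P E))%R.
  by rewrite lt0r fine_eq0// PE0 fine_ge0.
have ip0 : (0 <= (fine (P E))^-1)%R by rewrite invr_ge0 ltW.
have @m' : {measure set (S * T) -> \bar R}.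
  refine (mscale (NngNum ip0) (pushforward (mrestr P mE) XY)).
  exact: mXY.
have m'val D : m' D = (fine (P E))^-1%:E * P (XY @^-1` D `&` E) by [].
have m'E A B : measurable A -> measurable B -> m' (A `*` B) = muX A * muY B.
  move=> mA mB; rewrite m'val.
  rewrite (_ : XY @^-1` (A `*` B) `&` E = X @^-1` A `&` (Y @^-1` B `&` E)).
    rewrite h// -[P E in LHS]fineK// muleC -!muleA -EFinM divff ?gt_eqF//.
    by rewrite mule1.
  by apply/seteqP; split => w /=; tauto.
rewrite (product_measure_unique m'E mC) m'val.
rewrite -[P E in RHS]fineK// muleAC -EFinM mulVf ?gt_eqF//.
by rewrite mul1e.
Qed.

End independent_pair.

Section chain_law.
Variables (R : realType) (d : nat) (U : 'rV[R]_d -> R) (eta : R) (hU : C2 U).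
Context dO (Omega : measurableType dO) (P : probability Omega R).
Variables (X0 : {RV P >-> 'rV[R]_d}) (u : nat -> {RV P >-> R})
  (xi xi' : nat -> {RV P >-> 'rV[R]_d}).
Hypothesis driving : rlmc_driving X0 u xi xi'.
Variable nu : probability 'rV[R]_d R.
Hypothesis X0_law : forall A, measurable A -> P (X0 @^-1` A) = nu A.

Local Notation Q := (rlmc_kernel eta hU).
Local Notation chain := (rlmc_chain X0 u xi xi' U eta).
Local Notation gauss := (std_gauss R d).
Local Notation unif := (uniform_prob (@ltr01 R)).
Local Notation index := (unit + (nat + (nat + nat)))%type.

Definition noise_from (n : nat) (i : index) : bool :=
  match i with
  | inl _ => false
  | inr (inl k) => (n <= k)%N
  | inr (inr (inl k)) => (n <= k)%N
  | inr (inr (inr k)) => (n <= k)%N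
  end.

Let Xn n := rlmc_chain X0 u xi xi' U eta n.

Lemma measurable_chain n : measurable_fun setT (Xn n).
Proof.
elim: n => [|n IH]; first exact: measurable_funPT.
by apply: measurable_rlmc_step => //; exact: measurable_funPT.
Qed.

Let pre d' (T : measurableType d') (f : Omega -> T) A :
  measurable_fun setT f -> measurable A -> measurable (f @^-1` A).
Proof. by move=> mf mA; rewrite -[X in measurable X]setTI; exact: mf. Qed.

Let rlmc_sigma_measurable i A : rlmc_sigma X0 u xi xi' i A -> measurable A.
Proof.
by case: i => [t|[k|[k|k]]] /= [B mB <-]; rewrite setTI; apply: pre => //;
  exact: measurable_funPT.
Qed.

Let measurable_event (s : seq index) (A : index -> set Omega) :
  (forall i, i \in s -> rlmc_sigma X0 u xi xi' i (A i)) ->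
  measurable (\bigcap_(i in [set` s]) A i).
Proof.
move=> hA; apply: fin_bigcap_measurable; first exact: finite_seq.
by move=> i /= si; exact: rlmc_sigma_measurable (hA i si).
Qed.

Let bigcap_cons (i0 : index) (s : seq index) (A : index -> set Omega) :
  \bigcap_(i in [set` i0 :: s]) A i = A i0 `&` \bigcap_(i in [set` s]) A i.
Proof.
apply/seteqP; split => [w h|w [h0 h] i /=]; last first.
  by rewrite inE => /predU1P[->//|]; exact: h.
split; first by apply: h; rewrite /= mem_head.
by move=> i /= si; apply: h; rewrite /= inE si orbT.
Qed.

(** By induction on [n]: on any event of the later noise, the joint law of the
    state and of the three noise variables of time [n] is determined by its
    rectangles, so that it is the product law; its image under the update is
    the law of the next state. *)
Lemma chain_independence n (s : seq index) (A : index -> set Omega) B :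
  uniq s -> (forall i, i \in s -> noise_from n i) ->
  (forall i, i \in s -> rlmc_sigma X0 u xi xi' i (A i)) ->
  measurable B ->
  P (Xn n @^-1` B `&` \bigcap_(i in [set` s]) A i) =
    (kiter Q nu n B * P (\bigcap_(i in [set` s]) A i))%E.
Proof.
have indep := driving_indep driving.
elim: n s A B => [|n IH] s A B us hs hA mB.
  pose A' i := if i is inl _ then X0 @^-1` B else A i.
  have A'E i : i \in s -> A' i = A i by move=> /hs; case: i.
  have capE : \bigcap_(i in [set` s]) A' i = \bigcap_(i in [set` s]) A i.
    by apply: eq_bigcapr => i /=; exact: A'E.
  have := indep (inl tt :: s) A'; rewrite bigcap_cons capE /= => ->.
  - rewrite big_cons X0_law//; congr (_ * _)%E.
    rewrite -capE indep// => i si.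
    by rewrite A'E//; exact: hA.
  - by rewrite us andbT; apply/negP => /hs.
  - move=> i; rewrite inE => /predU1P[->|si]; last by rewrite A'E//; exact: hA.
    by exists B => //; rewrite setTI.
pose E := \bigcap_(i in [set` s]) A i.
have mE : measurable E by exact: measurable_event.
rewrite -/E.
have mXn := measurable_chain n.
(* The same function, seen with the measurable structure on which the uniform
   law is defined. *)
pose un : Omega -> measurableTypeR R := u n.
have mu : measurable_fun setT un by exact: (@measurable_funPT _ _ _ _ (u n)).
have mxi : measurable_fun setT (xi n) by exact: measurable_funPT.
have mxi' : measurable_fun setT (xi' n) by exact: measurable_funPT.
pose iu : index := inr (inl n).
pose ixi : index := inr (inr (inl n)).
pose ixi' : index := inr (inr (inr n)).
(* The rectangles are gathered into the product one factor at a time. *)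
have h4 B0 B1 B2 B3 : measurable B0 -> measurable B1 -> measurable B2 ->
    measurable B3 ->
    (P (Xn n @^-1` B0 `&` (un @^-1` B1 `&` (xi n @^-1` B2 `&`
        (xi' n @^-1` B3 `&` E)))) =
      kiter Q nu n B0 * (unif B1 * (gauss B2 * (gauss B3 * P E))))%E.
  move=> mB0 mB1 mB2 mB3.
  pose A' i := if i == iu then un @^-1` B1 else if i == ixi then xi n @^-1` B2
    else if i == ixi' then xi' n @^-1` B3 else A i.
  have A'E i : i \in s -> A' i = A i.
    move=> /hs; rewrite /A'; case: eqP => [->|_] /=; first by rewrite ltnn.
    case: eqP => [->|_] /=; first by rewrite ltnn.
    by case: eqP => [->|_] //=; rewrite ltnn.
  have A'u : A' iu = un @^-1` B1 by rewrite /A' eqxx.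
  have A'xi : A' ixi = xi n @^-1` B2 by rewrite /A' eqxx.
  have A'xi' : A' ixi' = xi' n @^-1` B3 by rewrite /A' eqxx.
  have capE : \bigcap_(i in [set` s]) A' i = E.
    by apply: eq_bigcapr => i /=; exact: A'E.
  have ns i : i \in s -> noise_from n i.
    by move=> /hs; case: i => [//|[k|[k|k]]] /=; exact: ltnW.
  have sig i : i \in [:: iu, ixi, ixi' & s] -> rlmc_sigma X0 u xi xi' i (A' i).
    rewrite !inE => /or4P[/eqP->|/eqP->|/eqP->|si].
    - by rewrite A'u; exists B1 => //; rewrite setTI.
    - by rewrite A'xi; exists B2 => //; rewrite setTI.
    - by rewrite A'xi'; exists B3 => //; rewrite setTI.
    - by rewrite A'E//; exact: hA.
  have nots i : i \in [:: iu; ixi; ixi'] -> i \notin s.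
    rewrite !inE => /or3P[/eqP->|/eqP->|/eqP->]; apply/negP => /hs /=;
      by rewrite ltnn.
  have us' : uniq [:: iu, ixi, ixi' & s].
    by rewrite /= !inE !negb_or us !nots ?inE ?eqxx ?orbT.
  have := IH [:: iu, ixi, ixi' & s] A' B0 us' _ sig mB0.
  rewrite indep// !bigcap_cons capE !big_cons A'u A'xi A'xi' => ->; last first.
    move=> i; rewrite !inE => /or4P[/eqP->|/eqP->|/eqP->|si] /=;
      rewrite ?leqnn//.
    exact: ns.
  rewrite -capE indep//; last first.
    by move=> i si; apply: sig; rewrite !inE si !orbT.
  by rewrite (u_uniform driving)// (xi_gauss driving)// (xi'_gauss driving).
have h3 B0 B1 C : measurable B0 -> measurable B1 -> measurable C ->
    (P (Xn n @^-1` B0 `&` (un @^-1` B1 `&`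
        ((fun w => (xi n w, xi' n w)) @^-1` C `&` E))) =
      kiter Q nu n B0 * (unif B1 * ((gauss \x gauss) C * P E)))%E.
  move=> mB0 mB1 mC.
  have E' : (P (Xn n @^-1` B0 `&` (un @^-1` B1 `&` E)) =
      kiter Q nu n B0 * (unif B1 * P E))%E.
    have := h4 B0 B1 setT setT mB0 mB1 measurableT measurableT.
    by rewrite !preimage_setT !setTI !probability_setT !mul1e.
  have mE' : measurable (Xn n @^-1` B0 `&` (un @^-1` B1 `&` E)).
    by apply: measurableI; [exact: pre|apply: measurableI => //; exact: pre].
  have := independent_pair (P := P) (muX := gauss) (muY := gauss)
    mxi mxi' mE' _ mC.
  rewrite E' => h.
  transitivity (P ((fun w => (xi n w, xi' n w)) @^-1` C `&`
      (Xn n @^-1` B0 `&` (un @^-1` B1 `&` E)))).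
    by rewrite !(setICA (_ @^-1` C)).
  rewrite h => [|B2 B3 mB2 mB3].
    by rewrite muleCA; congr (_ * _)%E; rewrite muleCA.
  rewrite (_ : _ `&` _ = Xn n @^-1` B0 `&` (un @^-1` B1 `&` (xi n @^-1` B2 `&`
        (xi' n @^-1` B3 `&` E)))); last first.
    by rewrite !(setICA _ (un @^-1` B1)) !(setICA _ (Xn n @^-1` B0)).
  rewrite h4//.
  rewrite [in RHS](muleCA (gauss B3)) [in RHS](muleCA (gauss B2)).
  congr (_ * _)%E.
  by rewrite [in RHS](muleCA (gauss B3)) [in RHS](muleCA (gauss B2)).
have mxx : measurable_fun setT (fun w => (xi n w, xi' n w)).
  exact: measurable_fun_pair.
have h2 B0 C : measurable B0 -> measurable C ->
    (P (Xn n @^-1` B0 `&`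
        ((fun w => (un w, (xi n w, xi' n w))) @^-1` C `&` E)) =
      kiter Q nu n B0 * (rlmc_noise R d C * P E))%E.
  move=> mB0 mC.
  have E' : (P (Xn n @^-1` B0 `&` E) = kiter Q nu n B0 * P E)%E.
    have := h3 B0 setT setT mB0 measurableT measurableT.
    by rewrite !preimage_setT !setTI !probability_setT !mul1e.
  have mE' : measurable (Xn n @^-1` B0 `&` E).
    by apply: measurableI => //; exact: pre.
  have := independent_pair (P := P) (muX := unif) (muY := (gauss \x gauss)%E)
    mu mxx mE' _ mC.
  rewrite E' => h.
  transitivity (P ((fun w => (un w, (xi n w, xi' n w))) @^-1` C `&`
      (Xn n @^-1` B0 `&` E))).
    by rewrite !(setICA (_ @^-1` C)).
  rewrite h => [|B1 D mB1 mD]; first by rewrite muleCA.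
  rewrite (_ : _ `&` _ = Xn n @^-1` B0 `&` (un @^-1` B1 `&`
        ((fun w => (xi n w, xi' n w)) @^-1` D `&` E))); last first.
    by rewrite !(setICA _ (Xn n @^-1` B0)).
  rewrite h3//.
  by rewrite [in RHS](muleCA ((gauss \x gauss)%E D)) [in RHS](muleCA (unif B1)).
have muxx : measurable_fun setT (fun w => (un w, (xi n w, xi' n w))).
  exact: measurable_fun_pair.
pose W := (fun p => rlmc_update eta hU p.1 p.2) @^-1` B.
have mW : measurable W.
  rewrite /W -[X in measurable X]setTI.
  exact: (measurable_rlmc_update eta hU).
have := independent_pair (P := P) (muX := kiter Q nu n) (muY := rlmc_noise R d)
  mXn muxx mE h2 mW.
have stepE : Xn n.+1 @^-1` B =
  (fun w => (Xn n w, (un w, (xi n w, xi' n w)))) @^-1` W by [].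
have kactE : kiter Q nu n.+1 B = (\int[kiter Q nu n]_x Q x B)%E by [].
move=> hW; rewrite stepE kactE; refine (etrans hW _).
rewrite product_xsectionE; refine (congr1 (fun t => t * P E)%E _).
apply: eq_integral => x _.
have QE : Q x B = rlmc_noise R d (rlmc_update eta hU x @^-1` B) by [].
rewrite QE; congr (rlmc_noise R d _).
by apply/seteqP; split => z; rewrite /xsection /= ?inE// => /set_mem.
Qed.

Lemma chain_law n A : measurable A -> P (chain n @^-1` A) = kiter Q nu n A.
Proof.
move=> mA; have := @chain_independence n [::] (fun=> setT) A isT.
rewrite (_ : \bigcap_(i in _) _ = setT); last exact/seteqP.
by rewrite setIT probability_setT mule1; apply.
Qed.

End chain_law.

(** * Exponential ergodicity of the randomized midpoint chain *)

Theorem theorem2p3 (R : realType) (d : nat) (U : 'rV[R]_d -> R) (m L : R)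
    (hU : C2 U) (gradU0 : grad U 0 = 0) (m_gt0 : 0 < m) (m_lt_L : m < L)
    (hessU : forall x : 'rV[R]_d,
      loewner_le m%:M (hess U x) /\ loewner_le (hess U x) L%:M)
    (eta : R) (eta_gt0 : 0 < eta) (eta_le : eta <= m / L ^+ 2) :
  let V : 'rV[R]_d -> R := fun x => 1 + sqenorm x in
  let Q : R.-pker 'rV[R]_d ~> 'rV[R]_d := rlmc_kernel eta hU in
  (forall (dO : measure_display) (Omega : measurableType dO)
      (P : probability Omega R) (X0 : {RV P >-> 'rV[R]_d})
      (u : nat -> {RV P >-> R}) (xi xi' : nat -> {RV P >-> 'rV[R]_d}),
    rlmc_driving X0 u xi xi' ->
    forall (nu : probability 'rV[R]_d R),
    (forall A, measurable A -> P (X0 @^-1` A) = nu A) ->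
    forall (n : nat) (A : set 'rV[R]_d), measurable A ->
      P (rlmc_chain X0 u xi xi' U eta n @^-1` A) = kiter Q nu n A) /\
  exists pi : probability 'rV[R]_d R,
    [/\ invariant_measure Q pi,
        (forall pi' : probability 'rV[R]_d R, invariant_measure Q pi' ->
          forall A, measurable A -> pi' A = pi A)
      & exists C c : R,
        [/\ 0 < C, 0 < c
          & forall nu : probability 'rV[R]_d R,
              (\int[nu]_x (V x)%:E < +oo)%E ->
              forall n : nat, (1 <= n)%N ->
              (dTV V (kiter Q nu n) pi <=
                C%:E * (1 + \int[nu]_x (V x)%:E) *
                  (expR (- (c * n%:R)))%:E)%E]].
Proof.
move=> V Q; split.
  move=> dO Omega P X0 u xi xi' driving nu X0_law n A mA.
  exact: (chain_law eta hU driving X0_law n mA).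
have V_ge0 (x : 'rV[R]_d) : 0 <= V x by rewrite /V addr_ge0// sqenorm_ge0.
have mV : measurable_fun setT V.
  by apply: measurable_funD => //; exact: measurable_sqenorm.
have [lam [K [lam0 lam1 K0 drift]]] :=
  rlmc_kernel_drift hU gradU0 m_gt0 m_lt_L hessU eta_gt0 eta_le.
have [pi [inv uniq [C [c [C0 c0 conv]]]]] :=
  harris V_ge0 mV lam0 lam1 K0 drift
    (rlmc_kernel_minorization hU gradU0 m_gt0 m_lt_L hessU eta_gt0 eta_le).
exists pi; split => //; exists C, c; split => // nu nuV n _.
exact: conv.
Qed.
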